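(* Consider the freeway model described in the context, with its true parameter vector $\theta=(P,(v_i^*;i\notin R),r)$ fixed and all the standing assumptions listed there. If $b_i>0$ ($i\in R$), $v_{i,\max}$ ($i\notin R$) and $\tau>0$ are sufficiently small, then the adaptive controller below has properties 1) and 2) below. Precisely: there exists $\eta>0$, depending only on $n$, $R$, $a_i,q_i,c_i,f_i,\mu_i$ ($i=1,\ldots,n$), $P_i$ ($i=1,\ldots,n-1$) and $v_{i,\max}$ ($i\in R$), such that whenever $b_i\le\eta$ ($i\in R$) and $v_{i,\max}\le\eta$ ($i\notin R$), there exists $\bar\tau>0$ such that for every $\tau\in(0,\bar\tau)$ the following holds for the closed loop of $$x^+=\overline F(d,\theta,x,u),\qquad y=(x,Q_{out},Q),\qquad u=k(\hat\theta,x),\qquad \hat\theta=(\hat P,(\hat v_i^*;i\notin R),\hat r),$$ with the dynamic law with state $w=(w_1,w_2,w_3)\in Y$, $\hat\theta\in\Theta$ given by $$w_1^+=x,\quad w_2^+=Q_{out},\quad w_3^+=Q;$$ if $w\notin A$: $\hat\theta^+=\hat\theta$; and if $w\in A$: $$\hat P_i^+=\min\left(1-\varepsilon,\frac{w_{2,i}}{w_{2,i}+w_{3,i}}\right),\quad i=1,\ldots,n-1,$$ $$(\hat v_i^* )^+=\max\left(0,\min(v_{i,\max},x_i-w_{1,i}+w_{3,i}+w_{2,i}-w_{3,i-1})\right),\quad i\in\{2,\ldots,n-1\}\setminus R,$$ $$(\hat v_n^* )^+=\max\left(0,\min(v_{n,\max},x_n-w_{1,n}+w_{2,n}-w_{3,n-1})\right)\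 \text{ if } n\notin R,$$ $$(\hat v_1^* )^+=\max\left(0,\min(v_{1,\max},x_1-w_{1,1}+w_{3,1}+w_{2,1})\right)\ \text{ if } 1\notin R,$$ $$\hat r_i^+=\max\left(\varepsilon,\min\left(1-\varepsilon,\frac{w_{2,i}+w_{3,i}}{w_{1,i}}\right)\right),\ i=1,\ldots,n-1,\qquad \hat r_n^+=\max\left(\varepsilon,\min\left(1-\varepsilon,\frac{w_{2,n}}{w_{1,n}}\right)\right),$$ where at each time $(\hat v_i^*;i\in R)=g(\hat\theta)$ and $\hat v^*=(\hat v_1^*,\ldots,\hat v_n^* )$: 1) There exist constants $M,\bar\sigma>0$ such that for every sequence $\{d(i)\in D\}_{i=0}^\infty$ and every initial condition $(x(0),w(0),\hat\theta(0))\in S\times Y\times\Theta$, the closed-loop solution satisfies for all $t\ge0$ $$|x(t)-x^*|+|w(t)-y^*|+|\hat r(t)-r|+|\hat P(t)-P|+|\hat v^*(t)-v^*|$$ $$\le M\exp(-\bar\sigma t)\left(|x(0)-x^*|+|w(0)-y^*|+|\hat r(0)-r|+|\hat P(0)-P|+\sum_{i\notin R}|\hat v_i^*(0)-v_i^*|\right).$$ 2) There exists an integer $N\ge1$ such that for every sequence $\{d(i)\in D\}_{i=0}^\infty$ and every initial condition $(x(0),w(0),\hat\theta(0))\in S\times Y\times\Theta$, the closed-loop solution satisfies $\hat P(t)=P$, $\hat r(t)=r$, $\hat v^*(t)=v^*$ for all $t\ge N$.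
   Context: Notation: $\mathbb{R}_+=[0,\infty)$; $|\cdot|$ is the Euclidean norm; $z^+$ denotes the next-step value $z(t+1)$; for an index set $R$, $(v_i;i\in R)$ is the vector of the $v_i$ with $i\in R$ in increasing order; time $t$ is a non-negative integer. **Freeway model.** Let $n\ge3$, and for $i=1,\ldots,n$ let $a_i>0$, $q_i>0$, $c_i\in(0,1]$, and $f_i:[0,a_i]\to\mathbb{R}_+$ with $0<f_i(z)<z$ for $z\in(0,a_i]$. Assume there are constants $\delta_i\in(0,a_i]$, $r_i\in(0,1)$, $f_i^{\min}>0$ with $f_i(z)=r_iz$ for $z\in[0,\delta_i]$ and $r_i\delta_i\ge f_i(z)\ge f_i^{\min}$ for $z\in[\delta_i,a_i]$. Let $P_i\in[0,1)$ for $i=1,\ldots,n-1$. Put $S=\prod_{i=1}^n(0,a_i]$, $D=[0,1]^{n-1}$. For $x\in S$, $d=(d_2,\ldots,d_n)\in D$ and inflows $v=(v_1,\ldots,v_n)\in(0,\infty)\times\mathbb{R}_+^{n-1}$ define for $i=2,\ldots,n$ $$s_i=(1-d_i)\min\left(1,\max\left(0,\frac{\min(q_i,c_i(a_i-x_i))-v_i}{(1-P_{i-1})f_{i-1}(x_{i-1})}\right)\right)+d_i\min\left(1,\frac{\min(q_i,c_i(a_i-x_i))}{(1-P_{i-1})f_{i-1}(x_{i-1})}\right).$$ The model $x^+=\tilde F(d,x,v)$ is $$x_1^+=x_1-s_2f_1(x_1)+\min(q_1,c_1(a_1-x_1),v_1),$$ $$x_i^+=x_i-s_{i+1}f_i(x_i)+\min(q_i,c_i(a_i-x_i),v_i+(1-P_{i-1})f_{i-1}(x_{i-1})),\quad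 i=2,\ldots,n-1,$$ $$x_n^+=x_n-f_n(x_n)+\min(q_n,c_n(a_n-x_n),v_n+(1-P_{n-1})f_{n-1}(x_{n-1})).$$ **Equilibrium.** $v^*=(v_1^*,\ldots,v_n^* )\in(0,\infty)\times\mathbb{R}_+^{n-1}$ satisfies $v_1^*<\min(q_1,c_1(a_1-\delta_1),r_1\delta_1)$ and $v_i^*+\sum_{j=1}^{i-1}v_j^*\prod_{k=j}^{i-1}(1-P_k)<\min(q_i,c_i(a_i-\delta_i),r_i\delta_i)$ for $i=2,\ldots,n$. The uncongested equilibrium $x^*$ is $x_1^*=r_1^{-1}v_1^*$, $x_i^*=r_i^{-1}\left(v_i^*+\sum_{j=1}^{i-1}v_j^*\prod_{k=j}^{i-1}(1-P_k)\right)$, $i=2,\ldots,n$. **Bounds.** $\mu_i\in(0,\delta_i)$ and $v_{i,\max}\in(0,\infty)$ ($i=1,\ldots,n$) satisfy $v_{1,\max}<\min(q_1,c_1(a_1-\mu_1))$ and $v_{i,\max}+(1-P_{i-1})r_{i-1}\mu_{i-1}<\min(q_i,c_i(a_i-\mu_i))$ for $i=2,\ldots,n$. $\Omega=\prod_{i=1}^n(0,\mu_i)$. $R\subseteq\{1,\ldots,n\}$ is a non-empty subset of the indices with $v_i^*>0$, $b_i\in(0,v_i^* )$ for $i\in R$, $\sigma\in(0,1]$, $\varepsilon\in(0,1/2)$. It is assumed that $x^*\in\prod_{i=1}^n(0,\mu_i-\varepsilon]$, $v_i^*\in[b_i+\varepsilon,v_{i,\max}]$ for $i\in R$, $v^*\in(0,v_{1,\max}]\times\prod_{i=2}^n[0,v_{i,\max}]$,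 $P_i\in[0,1-\varepsilon]$ for $i=1,\ldots,n-1$ and $r_i\in[\varepsilon,1-\varepsilon]$ for $i=1,\ldots,n$. **Nominal stabilization.** $R$, $\sigma$, $b_i$ ($i\in R$) are chosen so that, for some $\tau^*>0$ and every $\tau\in(0,\tau^* )$, the point $x^*$ is Robustly Globally Exponentially Stable (RGES) for $x^+=\tilde F(d,x,v)$ with $v_i=\max\left(b_i,v_i^*-\tau^{-1}(v_i^*-b_i)\sum_{j=1}^n\sigma^j\max(0,x_j-x_j^* )\right)$ for $i\in R$ and $v_i=v_i^*$ for $i\notin R$; that is, there are constants $M_0,\sigma_0>0$ with $|x(t)-x^*|\le M_0e^{-\sigma_0t}|x(0)-x^*|$ for all $t\ge0$, all $x(0)\in S$ and all sequences $d(t)\in D$. **Parameters and controller.** The true parameter vector is $\theta=(P,(v_i^*;i\notin R),r)\in\Theta:=[0,1-\varepsilon]^{n-1}\times\prod_{i\notin R}[0,v_{i,\max}]\times[\varepsilon,1-\varepsilon]^n$, with $P=(P_1,\ldots,P_{n-1})$, $r=(r_1,\ldots,r_n)$. There is a smooth function $g:\Theta\to\prod_{i\in R}[b_i+\varepsilon,v_{i,\max}]$ with $(v_i^*;i\in R)=g(\theta)$. The control is $u=(v_i;i\in R)\in U=\prod_{i\in R}[b_i,v_{i,\max}]$, and $\overline F(d,\theta,x,u)=\tilde F(d,x,v)$ where $(v_i;i\in R)=u$ and $v_i=v_i^*$ for $i\notin R$. For $\hat\theta=(\hat P,(\hat v_i^*;i\notin R),\hat r)\in\Theta$ and $x\in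 S$ set $(\hat v_i^*;i\in R)=g(\hat\theta)$, $\hat x_1^*=\min(\hat r_1^{-1}\hat v_1^*,\mu_1-\varepsilon)$, $\hat x_i^*=\min\left(\hat r_i^{-1}\left(\hat v_i^*+\sum_{j=1}^{i-1}\hat v_j^*\prod_{k=j}^{i-1}(1-\hat P_k)\right),\mu_i-\varepsilon\right)$ for $i=2,\ldots,n$, $\Xi(\hat\theta,x)=\sum_{i=1}^n\sigma^i\max(0,x_i-\hat x_i^* )$, and define $k(\hat\theta,x)=(k_i(\hat\theta,x);i\in R)$ by $k_i(\hat\theta,x)=\max\left(b_i,\hat v_i^*-\tau^{-1}(\hat v_i^*-b_i)\Xi(\hat\theta,x)\right)$, where $\tau>0$. **Output.** $y=(x,Q_{out},Q)\in Y:=S\times\prod_{i=1}^n[0,a_i]\times\prod_{i=1}^{n-1}[0,a_i]$, where $Q_{i,out}=P_is_{i+1}f_i(x_i)$ and $Q_i=(1-P_i)s_{i+1}f_i(x_i)$ for $i=1,\ldots,n-1$, $Q_{n,out}=f_n(x_n)$, with $s_{i+1}$ evaluated at the current $x,d,v$. The equilibrium output is $y^*=(x^*,Q_{out}^*,Q^* )$ with $Q^*_{i,out}=P_ir_ix_i^*$, $Q_i^*=(1-P_i)r_ix_i^*$ for $i=1,\ldots,n-1$ and $Q^*_{n,out}=r_nx_n^*$. The set $A\subseteq Y$ consists of all $w=(w_1,w_2,w_3)\in Y$ with $w_1\in\Omega$ and $w_{2,i}+w_{3,i}>0$ for $i=1,\ldots,n-1$. *)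

(* Defs.v *)
From mathcomp Require Import all_boot all_order all_algebra.
From mathcomp Require Import all_classical all_reals all_analysis.

Set Implicit Arguments.
Unset Strict Implicit.
Unset Printing Implicit Defensive.

Import Order.TTheory GRing.Theory Num.Theory.
Import numFieldNormedType.Exports.

Local Open Scope classical_set_scope.
Local Open Scope ring_scope.

(* Entries are addressed by 1-based natural numbers, so that the index shifts
   i - 1 and i + 1 of the model can be written directly; an index outside
   1, ..., m gives the junk value 0. *)
Definition ent (R : realType) (m : nat) (v : 'rV[R]_m) (i : nat) : R :=
  if i is k.+1 then (if insub k is Some j then v ord0 j else 0) else 0.

Notation "v # i" := (ent v i) (at level 8, i at level 2, format "v # i") : ring_scope.

Definition vec (R : realType) (m : nat) (F : nat -> R) : 'rV[R]_m :=
  \row_(j < m) F j.+1.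

Definition in1n (n i : nat) : bool := (1 <= i <= n)%N.

(* A set J : {set 'I_n} stands for the subset {j + 1 | j in J} of {1, ..., n};
   ix J is the increasing list of the elements of that subset. *)
Definition ix (n : nat) (J : {set 'I_n}) : seq nat :=
  [seq (val j).+1 | j <- enum J].

(* (v_i ; i in J), in increasing order of i *)
Definition subvec (R : realType) (n : nat) (J : {set 'I_n}) (v : 'rV[R]_n) :
  'rV[R]_#|J| := colsub (@enum_val _ (mem J)) v.

(* The v with (v_i ; i in J) = u and (v_i ; i notin J) = w. *)
Definition joinvec (R : realType) (n : nat) (J : {set 'I_n})
    (u : 'rV[R]_#|J|) (w : 'rV[R]_#|~: J|) : 'rV[R]_n :=
  vec n (fun i => if i \in ix J then u#((index i (ix J)).+1)
                  else w#((index i (ix (~: J))).+1)).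

(* The library norm on matrices is the sup norm. *)
Definition enorm (R : realType) (m : nat) (v : 'rV[R]_m) : R :=
  Num.sqrt (\sum_j v ord0 j ^+ 2).

Fixpoint Ck (R : realType) (V W : normedModType R) (k : nat) (h : V -> W) : Prop :=
  continuous h /\
  if k is k'.+1 then
    forall e : V, (forall x, derivable h x e) /\ Ck k' (fun x => 'D_e h x)
  else True.

(* Smoothness on a closed set A: restriction to A of a C^oo map. *)
Definition smooth_on (R : realType) (V W : normedModType R) (A : set V) (g : V -> W)
  : Prop :=
  exists h : V -> W, (forall k, Ck k h) /\ {in A, h =1 g}.

(* RGES of xst for x^+ = F(d, x), with states in S and disturbances in D. *)
Definition RGES (R : realType) (n m : nat) (S : set 'rV[R]_n) (D : set 'rV[R]_m)
    (F : 'rV[R]_m -> 'rV[R]_n -> 'rV[R]_n) (xst : 'rV[R]_n) : Prop :=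
  exists M0 s0 : R, [/\ 0 < M0, 0 < s0 &
    forall (d : nat -> 'rV[R]_m) (x : nat -> 'rV[R]_n),
      (forall t, d t \in D) -> x 0%N \in S ->
      (forall t, x t.+1 = F (d t) (x t)) ->
      forall t, enorm (x t - xst) <= M0 * expR (- (s0 * t%:R)) * enorm (x 0%N - xst)].

Section Freeway.
Variables (R : realType) (n : nat).
Variables (a q c : 'rV[R]_n) (f : nat -> R -> R).

(* Only f 1, ..., f n are relevant, and f i only on [0, a_i].
   Indexing: P = (P_1, ..., P_(n-1)) and d = (d_2, ..., d_n), so that d_i is the
   (i-1)-th entry of d. *)

Record freeway_model (delta r fmin : 'rV[R]_n) (P : 'rV[R]_n.-1) : Prop := {
  fm_a : forall i, in1n n i -> 0 < a#i;
  fm_q : forall i, in1n n i -> 0 < q#i;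
  fm_c : forall i, in1n n i -> 0 < c#i <= 1;
  fm_f_ge0 : forall i z, in1n n i -> 0 <= z <= a#i -> 0 <= f i z;
  fm_f_lt : forall i z, in1n n i -> 0 < z <= a#i -> 0 < f i z < z;
  fm_delta : forall i, in1n n i -> 0 < delta#i <= a#i;
  fm_r : forall i, in1n n i -> 0 < r#i < 1;
  fm_fmin : forall i, in1n n i -> 0 < fmin#i;
  fm_f_lin : forall i z, in1n n i -> 0 <= z <= delta#i -> f i z = r#i * z;
  fm_f_cong : forall i z, in1n n i -> delta#i <= z <= a#i ->
    fmin#i <= f i z <= r#i * delta#i;
  fm_P : forall i, in1n n.-1 i -> 0 <= P#i < 1 }.

Definition state_set : set 'rV[R]_n :=
  [set x | forall i, in1n n i -> 0 < x#i <= a#i].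

Definition dist_set : set 'rV[R]_n.-1 :=
  [set d | forall i, (2 <= i <= n)%N -> 0 <= d#i.-1 <= 1].

Definition supply (x : 'rV[R]_n) (i : nat) : R :=
  Num.min (q#i) (c#i * (a#i - x#i)).

Definition demand (P : 'rV[R]_n.-1) (x : 'rV[R]_n) (i : nat) : R :=
  (1 - P#i) * f i (x#i).

(* s_i, for i = 2, ..., n *)
Definition srv (P d : 'rV[R]_n.-1) (x v : 'rV[R]_n) (i : nat) : R :=
  (1 - d#i.-1) *
    Num.min 1 (Num.max 0 ((supply x i - v#i) / demand P x i.-1))
  + d#i.-1 * Num.min 1 (supply x i / demand P x i.-1).

Definition Ftilde (P d : 'rV[R]_n.-1) (x v : 'rV[R]_n) : 'rV[R]_n :=
  vec n (fun i =>
    if i == 1%N then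
      x#1 - srv P d x v 2 * f 1 (x#1) + Num.min (supply x 1) (v#1)
    else if i == n then
      x#n - f n (x#n) + Num.min (supply x n) (v#n + demand P x n.-1)
    else
      x#i - srv P d x v i.+1 * f i (x#i)
      + Num.min (supply x i) (v#i + demand P x i.-1)).

(* v_i + sum_(j = 1)^(i-1) v_j prod_(k = j)^(i-1) (1 - P_k), which is v_1 for i = 1 *)
Definition cumul (P : 'rV[R]_n.-1) (v : 'rV[R]_n) (i : nat) : R :=
  v#i + \sum_(1 <= j < i) v#j * \prod_(j <= k < i) (1 - P#k).

Definition xeq (P : 'rV[R]_n.-1) (r v : 'rV[R]_n) : 'rV[R]_n :=
  vec n (fun i => (r#i)^-1 * cumul P v i).

Record equilibrium_inflow (delta r : 'rV[R]_n) (P : 'rV[R]_n.-1) (vs : 'rV[R]_n)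
    : Prop := {
  eq_v1 : 0 < vs#1;
  eq_v : forall i, (2 <= i <= n)%N -> 0 <= vs#i;
  eq_lt : forall i, in1n n i ->
    cumul P vs i < Num.min (Num.min (q#i) (c#i * (a#i - delta#i))) (r#i * delta#i) }.

Record bounds (J : {set 'I_n}) (delta r : 'rV[R]_n) (P : 'rV[R]_n.-1)
    (vs mu vmax b : 'rV[R]_n) (sigma eps : R) : Prop := {
  bd_mu : forall i, in1n n i -> 0 < mu#i < delta#i;
  bd_vmax : forall i, in1n n i -> 0 < vmax#i;
  bd_vmax1 : vmax#1 < Num.min (q#1) (c#1 * (a#1 - mu#1));
  bd_vmaxi : forall i, (2 <= i <= n)%N ->
    vmax#i + (1 - P#i.-1) * r#i.-1 * mu#i.-1 < Num.min (q#i) (c#i * (a#i - mu#i));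
  bd_J0 : J != finset.set0;
  bd_J : forall i, i \in ix J -> 0 < vs#i;
  bd_b : forall i, i \in ix J -> 0 < b#i < vs#i;
  bd_sigma : 0 < sigma <= 1;
  bd_eps : 0 < eps < 2^-1;
  bd_xs : forall i, in1n n i -> 0 < (xeq P r vs)#i <= mu#i - eps;
  bd_vsJ : forall i, i \in ix J -> b#i + eps <= vs#i <= vmax#i;
  bd_vs1 : 0 < vs#1 <= vmax#1;
  bd_vs : forall i, (2 <= i <= n)%N -> 0 <= vs#i <= vmax#i;
  bd_P : forall i, in1n n.-1 i -> 0 <= P#i <= 1 - eps;
  bd_r : forall i, in1n n i -> eps <= r#i <= 1 - eps }.

Definition congestion (sigma : R) (xs x : 'rV[R]_n) : R :=
  \sum_(1 <= j < n.+1) sigma ^+ j * Num.max 0 (x#j - xs#j).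

Definition feedback (b : 'rV[R]_n) (sigma tau : R) (vs xs x : 'rV[R]_n) (i : nat) : R :=
  Num.max (b#i) (vs#i - tau^-1 * (vs#i - b#i) * congestion sigma xs x).

Definition nominal_input (J : {set 'I_n}) (b : 'rV[R]_n) (sigma tau : R)
    (vs xs x : 'rV[R]_n) : 'rV[R]_n :=
  vec n (fun i => if i \in ix J then feedback b sigma tau vs xs x i else vs#i).

Definition nominal_stabilization (J : {set 'I_n}) (P : 'rV[R]_n.-1)
    (r vs b : 'rV[R]_n) (sigma : R) : Prop :=
  exists2 taus : R, 0 < taus & forall tau : R, 0 < tau < taus ->
    RGES state_set dist_set
      (fun d x => Ftilde P d x (nominal_input J b sigma tau vs (xeq P r vs) x))
      (xeq P r vs).

(* theta = (P, (v_i^* ; i notin J), r) *)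
Definition param (J : {set 'I_n}) : Type :=
  ('rV[R]_n.-1 * 'rV[R]_#|~: J| * 'rV[R]_n)%type.

(* (x, Q_out, Q) *)
Definition output : Type := ('rV[R]_n * 'rV[R]_n * 'rV[R]_n.-1)%type.

Definition enorm_out (w : output) : R :=
  Num.sqrt (enorm w.1.1 ^+ 2 + enorm w.1.2 ^+ 2 + enorm w.2 ^+ 2).

Definition output_set : set output :=
  [set w | [/\ w.1.1 \in state_set,
    forall i, in1n n i -> 0 <= w.1.2#i <= a#i &
    forall i, in1n n.-1 i -> 0 <= w.2#i <= a#i]].

Definition yeq (P : 'rV[R]_n.-1) (r vs : 'rV[R]_n) : output :=
  let xs := xeq P r vs in
  (xs,
   vec n (fun i => if i == n then r#n * xs#n else P#i * r#i * xs#i),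
   vec n.-1 (fun i => (1 - P#i) * r#i * xs#i)).

Definition Omega_set (mu : 'rV[R]_n) : set 'rV[R]_n :=
  [set x | forall i, in1n n i -> 0 < x#i < mu#i].

Definition active_set (mu : 'rV[R]_n) : set output :=
  [set w | [/\ w \in output_set, w.1.1 \in Omega_set mu &
    forall i, in1n n.-1 i -> 0 < w.1.2#i + w.2#i]].

Section Adaptive.
Variables (J : {set 'I_n}).

Definition parP (th : param J) : 'rV[R]_n.-1 := th.1.1.
Definition parv (th : param J) : 'rV[R]_#|~: J| := th.1.2.
Definition parr (th : param J) : 'rV[R]_n := th.2.

Definition Theta_set (vmax : 'rV[R]_n) (eps : R) : set (param J) :=
  [set th | [/\ forall i, in1n n.-1 i -> 0 <= (parP th)#i <= 1 - eps,
    forall i, in1n #|~: J| i -> 0 <= (parv th)#i <= (subvec (~: J) vmax)#i &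
    forall i, in1n n i -> eps <= (parr th)#i <= 1 - eps]].

(* the vector \hat v^* of all the inflows determined by theta *)
Definition vfull (g : param J -> 'rV[R]_#|J|) (th : param J) : 'rV[R]_n :=
  joinvec (g th) (parv th).

Definition true_param (P : 'rV[R]_n.-1) (r vs : 'rV[R]_n) : param J :=
  (P, subvec (~: J) vs, r).

Record inflow_map (vmax b : 'rV[R]_n) (eps : R) (P : 'rV[R]_n.-1) (r vs : 'rV[R]_n)
    (g : param J -> 'rV[R]_#|J|) : Prop := {
  im_smooth : smooth_on (Theta_set vmax eps) g;
  im_range : forall th, th \in Theta_set vmax eps ->
    forall i, i \in ix J -> b#i + eps <= (vfull g th)#i <= vmax#i;
  im_true : g (true_param P r vs) = subvec J vs }.

Definition xhat (mu : 'rV[R]_n) (eps : R) (g : param J -> 'rV[R]_#|J|)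
    (th : param J) : 'rV[R]_n :=
  vec n (fun i => Num.min ((xeq (parP th) (parr th) (vfull g th))#i) (mu#i - eps)).

Definition controller (mu b : 'rV[R]_n) (sigma eps tau : R)
    (g : param J -> 'rV[R]_#|J|) (th : param J) (x : 'rV[R]_n) : 'rV[R]_#|J| :=
  subvec J (vec n (feedback b sigma tau (vfull g th) (xhat mu eps g th) x)).

(* Fbar depends on the component r of theta only through f. *)
Definition Fbar (d : 'rV[R]_n.-1) (th : param J) (x : 'rV[R]_n) (u : 'rV[R]_#|J|) :
  'rV[R]_n := Ftilde (parP th) d x (joinvec u (parv th)).

Definition measure_out (d : 'rV[R]_n.-1) (th : param J) (x : 'rV[R]_n)
    (u : 'rV[R]_#|J|) : output :=
  let P := parP th in
  let s := srv P d x (joinvec u (parv th)) in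
  (x,
   vec n (fun i => if i == n then f n (x#n) else P#i * s i.+1 * f i (x#i)),
   vec n.-1 (fun i => (1 - P#i) * s i.+1 * f i (x#i))).

Definition estimate (vmax : 'rV[R]_n) (eps : R) (x : 'rV[R]_n) (w : output) : param J :=
  let: (w1, w2, w3) := w in
  (vec n.-1 (fun i => Num.min (1 - eps) (w2#i / (w2#i + w3#i))),
   subvec (~: J) (vec n (fun i => Num.max 0 (Num.min (vmax#i)
     (if i == 1%N then x#1 - w1#1 + w3#1 + w2#1
      else if i == n then x#n - w1#n + w2#n - w3#n.-1
      else x#i - w1#i + w3#i + w2#i - w3#i.-1)))),
   vec n (fun i => Num.max eps (Num.min (1 - eps)
     (if i == n then w2#n / w1#n else (w2#i + w3#i) / w1#i)))).

Definition closed_loop (mu vmax b : 'rV[R]_n) (sigma eps tau : R)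
    (g : param J -> 'rV[R]_#|J|) (th0 : param J)
    (d : nat -> 'rV[R]_n.-1) (x : nat -> 'rV[R]_n) (w : nat -> output)
    (th : nat -> param J) : Prop :=
  forall t, let u := controller mu b sigma eps tau g (th t) (x t) in
  [/\ x t.+1 = Fbar (d t) th0 (x t) u,
      w t.+1 = measure_out (d t) th0 (x t) u &
      th t.+1 = if w t \in active_set mu then estimate vmax eps (x t) (w t) else th t].

Definition closed_loop_from (mu vmax b : 'rV[R]_n) (sigma eps tau : R)
    (g : param J -> 'rV[R]_#|J|) (th0 : param J)
    (d : nat -> 'rV[R]_n.-1) (x : nat -> 'rV[R]_n) (w : nat -> output)
    (th : nat -> param J) : Prop :=
  [/\ forall t, d t \in dist_set, x 0%N \in state_set, w 0%N \in output_set,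
      th 0%N \in Theta_set vmax eps &
      closed_loop mu vmax b sigma eps tau g th0 d x w th].

End Adaptive.
End Freeway.

(* Main.v *)
Require Import Defs.
From mathcomp Require Import all_boot all_order all_algebra.
From mathcomp Require Import all_classical all_reals all_analysis.
From mathcomp Require Import ring lra zify.
Import Order.TTheory GRing.Theory Num.Theory.
Import numFieldNormedType.Exports.
Local Open Scope classical_set_scope.
Local Open Scope ring_scope.

Set Implicit Arguments.
Unset Strict Implicit.
Unset Printing Implicit Defensive.

(* While some density is outside [Omega], the congestion term of the feedback
   is at least [sigma ^+ n * eps], so for small [tau] the controller applies the
   minimal inflows [b_i], whatever the parameter estimate. With all inflows at
   most [eta], the functional [mass x] (the sum over [m] of the content of the
   first [m] cells) then drops by a fixed amount per step: it loses the outflow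
   of every cell, and the last congested cell has an outflow bounded away from
   0. Hence every solution visits [Omega] before a uniform time. One visit is
   enough: in [Omega] the freeway is in free flow and the measurements determine
   the parameters exactly, and from then on an update can only reproduce the
   true parameters. This gives 2), and the exponential rate in 1) is that of the
   nominal closed loop. For the constant in 1), the finitely many steps of the
   transient are each Lipschitz at the equilibrium: [g] is Lipschitz at [theta]
   because it has continuous partial derivatives there. *)

(** * Entries and norms of row vectors *)

(** The total content of the freeway would not do as functional: it loses only what leaves through
    the exits, and downstream of a congested cell the cells may be almost empty and the exit
    fractions 0. Summing the contents of all prefixes brings the outflow of every single cell into
    the balance. [eta] has to be fixed before [r], [delta] and [fmin] are known, so the lower bound
    [k] on the outflow of a congested cell is expressed through [a], [q], [c], [f] and [mu] alone.
    1) asks for a bound proportional to the initial error, although the update of the estimate jumps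
    at the boundary of [active_set] and divides by measured quantities. Near the equilibrium [w] is
    always active and the denominators are bounded away from 0; once the error radius reaches some
    [rho > 0], a bound [K] on all errors is at most [K / rho] times that radius. *)

Section Entries.
Variable R : realType.

Lemma entS m (v : 'rV[R]_m) (j : 'I_m) : v#(j.+1) = v ord0 j.
Proof. by rewrite /ent insubT //= => h; congr (v _ _); apply/val_inj. Qed.

Lemma in1nP m i : reflect (exists j : 'I_m, i = j.+1) (in1n m i).
Proof.
apply: (iffP idP) => [|[j ->]]; last by rewrite /in1n /= ltn_ord.
by case: i => [//|k] h; exists (Ordinal h).
Qed.

Lemma ent_vec m (F : nat -> R) i : in1n m i -> (vec m F)#i = F i.
Proof. by case/in1nP => j ->; rewrite entS mxE. Qed.

Lemma ent_inj m (u v : 'rV[R]_m) : (forall i, in1n m i -> u#i = v#i) -> u = v.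
Proof.
move=> h; apply/rowP => j; have := h j.+1; rewrite !entS; apply.
by apply/in1nP; exists j.
Qed.

Lemma entB m (u v : 'rV[R]_m) i : (u - v)#i = u#i - v#i.
Proof.
rewrite /ent; case: i => [|k]; first by rewrite subr0.
by case: insub => [j|]; rewrite ?mxE ?subr0.
Qed.

Lemma mem_ixS m (K : {set 'I_m}) (j : 'I_m) : (j.+1 \in ix K) = (j \in K).
Proof.
rewrite /ix; apply/mapP/idP => [[k]|jK]; last by exists j; rewrite ?mem_enum.
by rewrite mem_enum => kK [] /val_inj ->.
Qed.

Lemma ix_in1n m (K : {set 'I_m}) i : i \in ix K -> in1n m i.
Proof. by case/mapP => j _ ->; apply/in1nP; exists j. Qed.

Lemma mem_ixC m (K : {set 'I_m}) i : in1n m i -> (i \in ix (~: K)) = (i \notin ix K).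
Proof. by case/in1nP => j ->; rewrite !mem_ixS inE. Qed.

Lemma index_ix m (K : {set 'I_m}) i : i \in ix K -> in1n #|K| (index i (ix K)).+1.
Proof.
by move=> iK; rewrite /in1n /= cardE -[size (enum K)](size_map (fun j : 'I_m => j.+1)) index_mem.
Qed.

Lemma ent_subvec m (K : {set 'I_m}) (v : 'rV[R]_m) i : i \in ix K ->
  (subvec K v)#((index i (ix K)).+1) = v#i.
Proof.
move=> iK; have /in1nP[k [ek]] := index_ix iK.
rewrite ek entS /subvec mxE -entS; congr (v # _).
by rewrite -[RHS](nth_index 0%N iK) ek /ix (nth_map (enum_val k)) -?cardE // -enum_val_nth.
Qed.

Lemma eq_subvec m (K : {set 'I_m}) (u v : 'rV[R]_m) :
  (forall i, i \in ix K -> u#i = v#i) -> subvec K u = subvec K v.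
Proof.
move=> h; apply/rowP => j; rewrite /subvec !mxE -!entS; apply: h.
by rewrite mem_ixS enum_valP.
Qed.

Lemma ent_joinvec m (K : {set 'I_m}) (u : 'rV[R]_#|K|) (w : 'rV[R]_#|~: K|) i :
  in1n m i -> (joinvec u w)#i = if i \in ix K then u#((index i (ix K)).+1)
                                else w#((index i (ix (~: K))).+1).
Proof. by move=> hi; rewrite ent_vec. Qed.

Lemma ent_joinvec_subvecl m (K : {set 'I_m}) (u : 'rV[R]_m) w i :
  i \in ix K -> (joinvec (subvec K u) w)#i = u#i.
Proof. by move=> iK; rewrite ent_joinvec ?(ix_in1n iK) // iK ent_subvec. Qed.

Lemma ent_joinvec_subvecr m (K : {set 'I_m}) (u : 'rV[R]_m) w i : in1n m i ->
  i \notin ix K -> (joinvec w (subvec (~: K) u))#i = u#i.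
Proof.
by move=> hi iK; rewrite ent_joinvec // (negbTE iK) ent_subvec // mem_ixC.
Qed.

Lemma joinvecK m (K : {set 'I_m}) (u : 'rV[R]_m) :
  joinvec (subvec K u) (subvec (~: K) u) = u.
Proof.
apply: ent_inj => i hi; have [iK|iK] := boolP (i \in ix K).
  by rewrite ent_joinvec_subvecl.
by rewrite ent_joinvec_subvecr.
Qed.

Lemma ent_le_enorm m (v : 'rV[R]_m) i : in1n m i -> `|v#i| <= enorm v.
Proof.
case/in1nP => j ->; rewrite entS -sqrtr_sqr ler_wsqrtr //.
by rewrite (bigD1 j) //= lerDl sumr_ge0 // => k _; apply: sqr_ge0.
Qed.

Lemma enorm_ge0 m (v : 'rV[R]_m) : 0 <= enorm v.
Proof. exact: sqrtr_ge0. Qed.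

(** The factor [m] in place of its square root is enough, as only the existence of constants
    matters. *)
Lemma enorm_le m (v : 'rV[R]_m) (B : R) : 0 <= B ->
  (forall i, in1n m i -> `|v#i| <= B) -> enorm v <= m%:R * B.
Proof.
move=> B0 h; rewrite -(ger0_norm (mulr_ge0 (ler0n R m) B0)) -sqrtr_sqr ler_wsqrtr //.
apply: (@le_trans _ _ (\sum_(j < m) B ^+ 2)).
  apply: ler_sum => j _; rewrite -[v ord0 j ^+ 2]real_normK ?num_real //.
  rewrite lerXn2r ?nnegrE //.
  by rewrite -entS h //; apply/in1nP; exists j.
rewrite sumr_const card_ord exprMn -[leLHS]mulr_natl ler_wpM2r ?sqr_ge0 //.
by rewrite -natrX ler_nat; case: m {v h} => // m; rewrite expnS expn1 leq_pmulr.
Qed.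

Lemma enorm_out_le n (w : output R n) (B : R) : 0 <= B ->
  enorm w.1.1 <= B -> enorm w.1.2 <= B -> enorm w.2 <= B -> enorm_out w <= 3 * B.
Proof.
move=> B0 h1 h2 h3; rewrite -[leRHS]ger0_norm ?mulr_ge0 // -sqrtr_sqr ler_wsqrtr //.
have sq (e : R) : 0 <= e -> e <= B -> e ^+ 2 <= B ^+ 2.
  by move=> e0 eB; rewrite lerXn2r ?nnegrE.
have := sq _ (enorm_ge0 _) h1; have := sq _ (enorm_ge0 _) h2.
have := sq _ (enorm_ge0 _) h3.
have := sqr_ge0 B; nra.
Qed.

Lemma enorm_out_ge n (w : output R n) :
  [/\ enorm w.1.1 <= enorm_out w, enorm w.1.2 <= enorm_out w & enorm w.2 <= enorm_out w].
Proof.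
have sq (e : R) : 0 <= e -> e = Num.sqrt (e ^+ 2).
  by move=> e0; rewrite sqrtr_sqr ger0_norm.
have p1 := sqr_ge0 (enorm w.1.1); have p2 := sqr_ge0 (enorm w.1.2).
have p3 := sqr_ge0 (enorm w.2).
by split; rewrite [leLHS]sq ?enorm_ge0 // ler_wsqrtr //; lra.
Qed.

End Entries.

(** * Lipschitz bounds from continuous partial derivatives *)

Section C1Lipschitz.
Variable R : realType.

Lemma rV_norm_le m (v : 'rV[R]_m) (B : R) : 0 <= B ->
  (forall j, `|v ord0 j| <= B) -> `|v| <= B.
Proof.
move=> B0 h; rewrite /Num.Def.normr /= mx_normrE bigmax_le // => -[i j] _ /=.
by rewrite (ord1 i).
Qed.

Lemma rV_norm_ge m (v : 'rV[R]_m) j : `|v ord0 j| <= `|v|.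
Proof. by rewrite [leRHS]/Num.Def.normr /= mx_normrE (le_bigmax _ _ (ord0, j)). Qed.

(** The mean value theorem is applied to each entry of [h] along the line; the sup norm makes the
    entrywise bounds sufficient, although the intermediate points differ. *)
Lemma mean_value_line (V : normedModType R) m (h : V -> 'rV[R]_m) (e y : V) (C t : R) :
  (forall x, derivable h x e) ->
  (forall s, `|s| <= `|t| -> `|derive h (y + s *: e) e| <= C) ->
  `|h (y + t *: e) - h y| <= C * `|t|.
Proof.
move=> dh bh.
have C0 : 0 <= C by apply: le_trans (bh 0 _); rewrite ?normr0.
apply: rV_norm_le => [|j]; first by rewrite mulr_ge0.
rewrite !mxE.
pose k : R -> R := fun s => h (y + s *: e) ord0 j.
have dk (s : R) : is_derive s 1 k ((derive h (y + s *: e) e) ord0 j).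
  have dhj := (derivable_mxP _ _ _).1 (dh (y + s *: e)) ord0 j.
  (* Moving [s] by [u] moves the argument of [h] by [u *: e], so the derivative of [k] is the
     directional derivative of the entry of [h]. *)
  have eqk : (fun u => k (u *: 1 + s)) =
             (fun u => h (u *: e + (y + s *: e)) ord0 j).
    by apply/funext => u; rewrite /k [u *: 1]mulr1 scalerDl addrCA.
  apply: DeriveDef.
    by apply: (derivable1P k s 1).2; rewrite eqk; apply: (derivable1P _ _ _).1 dhj.
  rewrite derive_mx // mxE /derive.
  have -> // : (fun u : R => u^-1 *: ((k \o shift s) (u *: (1 : R^o)) - k s)) =
      (fun u : R => u^-1 *: (((fun x => h x ord0 j) \o shift (y + s *: e)) (u *: e)
         - h (y + s *: e) ord0 j)).
  apply/funext => u; congr (_ *: (_ - _)).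
  exact: (congr1 (fun F : R -> R => F u) eqk).
have k0 : k 0 = h y ord0 j by rewrite /k scale0r addr0.
rewrite -/(k t) -k0.
have kc a b : {within `[a, b]%classic, continuous k}.
  by apply: derivable_within_continuous => z _; apply: ex_derive; exact: dk.
have bd s : `|s| <= `|t| -> `|derive h (y + s *: e) e ord0 j| <= C.
  by move=> st; apply: le_trans (bh s st); apply: rV_norm_ge.
have [t0|t0] := leP 0 t.
  have [s + ->] := MVT_segment t0 (fun z _ => dk z) (@kc _ _).
  rewrite in_itv /= => /andP[s0 st]; rewrite subr0 normrM ler_wpM2r //.
  by apply: bd; rewrite !ger0_norm.
have [s + eq] := MVT_segment (ltW t0) (fun z _ => dk z) (@kc _ _).
rewrite in_itv /= => /andP[s0 st]; rewrite distrC eq sub0r normrM normrN ler_wpM2r //.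
by apply: bd; rewrite (ler0_norm st) (ltr0_norm t0) lerN2.
Qed.

(** The increments are made one direction at a time. Each direction costs a bound on one derivative
    near [p] and a smaller radius, so that the intermediate points stay where the bounds hold. *)
Lemma C1_lipschitz_sum (V : normedModType R) m (h : V -> 'rV[R]_m) (p : V)
    (I : Type) (e : I -> V) (r : seq I) :
  (forall i x, derivable h x (e i)) ->
  (forall i, {for p, continuous (fun x => derive h x (e i))}) ->
  exists rho C : R, [/\ 0 < rho, 0 <= C & forall y t, `|y - p| < rho ->
    (forall i, `|t i| < rho) ->
    `|h (y + \sum_(i <- r) t i *: e i) - h y| <= C * \sum_(i <- r) `|t i|].
Proof.
move=> dh cdh; elim: r => [|i r [rho [C [rho0 C0 IH]]]].
  by exists 1, 0; split=> // y t _ _; rewrite !big_nil addr0 subrr normr0 mulr0.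
have /cvgrPdist_lt /(_ 1 ltr01) /nbhs_normP[r0 /= r00 hr0] := cdh i.
pose C' := `|derive h p (e i)| + 1.
have bD z : `|z - p| < r0 -> `|derive h z (e i)| <= C'.
  move=> zp; have /= := hr0 z; rewrite distrC => /(_ zp) /ltW h1.
  rewrite -[derive h z _](subKr (derive h p (e i))).
  by apply: le_trans (ler_normB _ _) _; rewrite lerD2l.
have e1 : 0 < 1 + `|e i| by rewrite ltr_pwDl.
pose m0 := Num.min rho r0.
have m00 : 0 < m0 by rewrite lt_min rho0.
(* The radius is [m0 / (1 + |e i|)] because the two displacements add up to less than [1 + |e i|]
   times it. *)
have stay y s : `|y - p| < m0 / (1 + `|e i|) -> `|s| < m0 / (1 + `|e i|) ->
    `|y + s *: e i - p| < m0.
  move=> h1 h2; rewrite addrAC; apply: le_lt_trans (ler_normD _ _) _.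
  rewrite normrZ -[ltRHS](divfK (lt0r_neq0 e1)) mulrDr mulr1 ltr_leD //.
  by rewrite ler_wpM2r // ltW.
have mle : m0 / (1 + `|e i|) <= m0.
  by rewrite ler_pdivrMr // ler_peMr ?(ltW m00) ?lerDl.
exists (m0 / (1 + `|e i|)), (C + C'); split.
- exact: divr_gt0.
- by rewrite addr_ge0 // addr_ge0.
move=> y t yp tb; rewrite !big_cons addrA.
have t0 := tb i.
have ymin := stay _ _ yp t0.
rewrite -(subrKA (h (y + t i *: e i))); apply: le_trans (ler_normD _ _) _.
have A1 : `|h (y + t i *: e i + \sum_(j <- r) t j *: e j) - h (y + t i *: e i)|
     <= C * \sum_(j <- r) `|t j|.
  apply: IH; first by apply: lt_le_trans ymin _; rewrite ge_min lexx.
  move=> j; apply: lt_le_trans (tb j) _; apply: le_trans mle _.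
  by rewrite ge_min lexx.
have A2 : `|h (y + t i *: e i) - h y| <= C' * `|t i|.
  apply: mean_value_line => // s st; apply: bD.
  apply: lt_le_trans (stay y s yp (le_lt_trans st t0)) _.
  by rewrite ge_min lexx orbT.
have S0 : 0 <= \sum_(j <- r) `|t j| by apply: sumr_ge0.
have C'0 : 0 <= C' by rewrite addr_ge0.
have := normr_ge0 (t i); nra.
Qed.

(** Start at [p] itself and move along the standard basis of the three blocks; the coefficients are
    the coordinates of [y - p], each at most its norm, which yields the number of coordinates as a
    factor. *)
Lemma C1_lipschitz_at (k1 k2 k3 m : nat)
    (h : 'rV[R]_k1 * 'rV[R]_k2 * 'rV[R]_k3 -> 'rV[R]_m) p :
  Ck 1 h -> exists rho C : R, [/\ 0 < rho, 0 <= C &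
    forall y, `|y - p| < rho -> `|h y - h p| <= C * `|y - p|].
Proof.
move=> [_ /= hh].
pose e (i : 'I_k1 + 'I_k2 + 'I_k3) : 'rV[R]_k1 * 'rV[R]_k2 * 'rV[R]_k3 :=
  match i with
  | inl (inl i) => (delta_mx 0 i, 0, 0)
  | inl (inr i) => (0, delta_mx 0 i, 0)
  | inr i => (0, 0, delta_mx 0 i) end.
have [rho [C [rho0 C0 H]]] := @C1_lipschitz_sum _ m h p _ e (index_enum _)
  (fun i => (hh (e i)).1) (fun i => (hh (e i)).2.1 p).
exists rho, (C * #|{: 'I_k1 + 'I_k2 + 'I_k3}|%:R); split=> //.
  by rewrite mulr_ge0.
move=> y yp; pose t (i : 'I_k1 + 'I_k2 + 'I_k3) : R :=
  match i with
  | inl (inl i) => (y - p).1.1 ord0 i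
  | inl (inr i) => (y - p).1.2 ord0 i
  | inr i => (y - p).2 ord0 i end.
have tb i : `|t i| <= `|y - p|.
  rewrite prod_normE le_max /t prod_normE le_max.
  by case: i => [[i|i]|i]; rewrite rV_norm_ge ?orbT.
have ey : y = p + \sum_i t i *: e i.
  have H1 : \sum_i t (inl (inl i)) *: e (inl (inl i)) = ((y - p).1.1, 0, 0).
    rewrite [in RHS](row_sum_delta (y - p).1.1).
    rewrite (big_morph (fun u : 'rV[R]_k1 => (u, 0 : 'rV[R]_k2, 0 : 'rV[R]_k3))
      (id1 := 0) (op1 := +%R)) // => [|u v].
      by apply: eq_bigr => i _; congr (_, _, _); rewrite scaler0.
    by congr (_, _, _); rewrite addr0.
  have H2 : \sum_i t (inl (inr i)) *: e (inl (inr i)) = (0, (y - p).1.2, 0).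
    rewrite [in RHS](row_sum_delta (y - p).1.2).
    rewrite (big_morph (fun u : 'rV[R]_k2 => (0 : 'rV[R]_k1, u, 0 : 'rV[R]_k3))
      (id1 := 0) (op1 := +%R)) // => [|u v].
      by apply: eq_bigr => i _; congr (_, _, _); rewrite scaler0.
    by congr (_, _, _); rewrite addr0.
  have H3 : \sum_i t (inr i) *: e (inr i) = (0, 0, (y - p).2).
    rewrite [in RHS](row_sum_delta (y - p).2).
    rewrite (big_morph (fun u : 'rV[R]_k3 => (0 : 'rV[R]_k1, 0 : 'rV[R]_k2, u))
      (id1 := 0) (op1 := +%R)) // => [|u v].
      by apply: eq_bigr => i _; congr (_, _, _); rewrite scaler0.
    by congr (_, _, _); rewrite addr0.
  rewrite big_sumType big_sumType /= H1 H2 H3.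
  case: (y) => [[y1 y2] y3]; case: (p) => [[p1 p2] p3].
  by congr (_, _, _) => /=; rewrite ?addr0 ?add0r addrC subrK.
rewrite {1}ey -mulrA; apply: le_trans (H _ _ _ _) _.
- by rewrite subrr normr0.
- by move=> i; apply: le_lt_trans (tb i) yp.
rewrite ler_wpM2l // mulr_natl -sumr_const; exact: ler_sum.
Qed.
End C1Lipschitz.

(** * The freeway model *)

Section Share.
Variables (R : realType).

(** Here [m] is the supply, [v] the ramp inflow and [D] the mainline demand. [s] is a convex
    combination of the two extreme rules [A] (ramp first) and [B] (mainline first), and each claim
    is preserved by convex combinations, so it is checked for [A] and [B] only. *)
Lemma share_spec (d m v D : R) : 0 <= d <= 1 -> 0 <= m -> 0 <= v -> 0 < D ->
  let s := (1 - d) * Num.min 1 (Num.max 0 ((m - v) / D)) + d * Num.min 1 (m / D) in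
  [/\ 0 <= s <= 1, Num.min m (v + D) <= v + s * D,
      Num.min D (m - v) <= s * D & v + D <= m -> s = 1].
Proof.
move=> /andP[d0 d1] m0 v0 D0 s.
have D1 : D != 0 by rewrite lt0r_neq0.
pose A := Num.min 1 (Num.max 0 ((m - v) / D)); pose B := Num.min 1 (m / D).
have A0 : 0 <= A by rewrite le_min ler01 le_max lexx.
have B0 : 0 <= B by rewrite le_min ler01 divr_ge0 // ltW.
have A1 : A <= 1 by rewrite ge_min lexx.
have B1 : B <= 1 by rewrite ge_min lexx.
have AD : A * D = Num.min D (Num.max 0 (m - v)).
  by rewrite /A minr_pMl ?ltW // maxr_pMl ?ltW // divfK // mul1r mul0r.
have BD : B * D = Num.min D m by rewrite /B minr_pMl ?ltW // divfK // mul1r.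
have Asat : v + D <= m -> A = 1.
  move=> h; apply/min_idPl; rewrite le_max ler_pdivlMr // mul1r.
  by apply/orP; right; rewrite lerBrDl.
have Bsat : v + D <= m -> B = 1.
  move=> h; apply/min_idPl; rewrite ler_pdivlMr // mul1r.
  by apply: le_trans h; rewrite lerDr.
have es : s = (1 - d) * A + d * B by [].
have sD : s * D = (1 - d) * (A * D) + d * (B * D) by rewrite es mulrDl !mulrA.
clearbody s A B.
have hA : Num.min m (v + D) <= v + A * D /\ Num.min D (m - v) <= A * D.
  rewrite AD; clear - m0 v0 D0.
  case: (leP 0 (m - v)) => h1;
    [case: (leP D (m - v))|case: (leP D 0) => ?; case: (leP D (m - v))] => ?;
    case: (leP m (v + D)) => ?; split; lra.
have hB : Num.min m (v + D) <= v + B * D /\ Num.min D (m - v) <= B * D.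
  rewrite BD; clear - m0 v0 D0.
  case: (leP D m) => ?; case: (leP m (v + D)) => ?;
    case: (leP D (m - v)) => ?; split; lra.
case: hA hB => [a1 a2] [b1 b2].
have d2 : 0 <= 1 - d by rewrite subr_ge0.
have conv (x y z : R) : x <= y -> x <= z -> x <= (1 - d) * y + d * z.
  move=> xy xz; have := ler_wpM2l d2 xy; have := ler_wpM2l d0 xz; lra.
split.
- rewrite es; apply/andP; split; first by rewrite addr_ge0 ?mulr_ge0.
  have := ler_wpM2l d2 A1; have := ler_wpM2l d0 B1; lra.
- have := conv _ _ _ a1 b1; rewrite sD; lra.
- by rewrite sD; apply: conv.
by move=> h; rewrite es Asat // Bsat //; lra.
Qed.

End Share.

(** * One constant for finitely many indices *)

Section UniformBounds.
Variables (R : realType) (n : nat) (Q : nat -> R -> Prop).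

Lemma uniform_lower_bound :
  (forall i k k', 0 < k' -> k' <= k -> Q i k -> Q i k') ->
  (forall i, in1n n i -> exists2 k : R, 0 < k & Q i k) ->
  exists2 k : R, 0 < k & forall i, in1n n i -> Q i k.
Proof.
move=> mono; elim: n => [|m IH] h.
  by exists 1 => // i; rewrite /in1n; case: i.
have [k k0 hk] := IH (fun i hi => h i (ltac:(move: hi; rewrite /in1n; clear; lia))).
have [k' k'0 hk'] := h m.+1 (ltac:(by rewrite /in1n ltnS leqnn)).
exists (Num.min k k') => [|i hi]; first by rewrite lt_min k0.
have m0 : 0 < Num.min k k' by rewrite lt_min k0.
have [->|ne] := eqVneq i m.+1; first by apply: mono hk'; rewrite ?ge_min ?lexx ?orbT.
apply: mono (hk i _); rewrite ?ge_min ?lexx //.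
by move: hi ne; rewrite /in1n; clear; lia.
Qed.

Lemma uniform_upper_bound :
  (forall i k k', k <= k' -> Q i k -> Q i k') ->
  (forall i, in1n n i -> exists k : R, Q i k) ->
  exists2 k : R, 0 <= k & forall i, in1n n i -> Q i k.
Proof.
move=> mono; elim: n => [|m IH] h.
  by exists 0 => // i; rewrite /in1n; case: i.
have [k k0 hk] := IH (fun i hi => h i (ltac:(move: hi; rewrite /in1n; clear; lia))).
have [k' hk'] := h m.+1 (ltac:(by rewrite /in1n ltnS leqnn)).
exists (Num.max k k') => [|i hi]; first by rewrite le_max k0.
have [->|ne] := eqVneq i m.+1; first by apply: mono hk'; rewrite le_max lexx orbT.
apply: mono (hk i _); rewrite ?le_max ?lexx //.
by move: hi ne; rewrite /in1n; clear; lia.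
Qed.

End UniformBounds.

(** * Flow balance of the cells and the mass functional *)

Section Freeway.
Variables (R : realType) (n : nat) (hn : (3 <= n)%N).
Variables (a q c : 'rV[R]_n) (f : nat -> R -> R) (delta r fmin : 'rV[R]_n) (P : 'rV[R]_n.-1).
Hypothesis fm : freeway_model a q c f delta r fmin P.

Definition nonneg_inflow (v : 'rV[R]_n) := forall i, in1n n i -> 0 <= v#i.

(** All that leaves cell [i], exit ramp included. With [arrival], the three cases of the model
    become the single balance law [Ftilde_ent]. *)
Definition outflow (d : 'rV[R]_n.-1) (x v : 'rV[R]_n) (i : nat) : R :=
  if i == n then f n (x#n) else srv a q c f P d x v i.+1 * f i (x#i).

Definition arrival (x v : 'rV[R]_n) (i : nat) : R :=
  v#i + (if i == 1%N then 0 else demand f P x i.-1).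

Lemma Ftilde_ent d x v i : in1n n i ->
  (Ftilde a q c f P d x v)#i =
    x#i - outflow d x v i + Num.min (supply a q c x i) (arrival x v i).
Proof.
move=> hi; rewrite ent_vec // /outflow /arrival.
have [->|i1] := eqVneq i 1%N; first by rewrite addr0 ifF //; apply/eqP; lia.
by have [->|i2] := eqVneq i n.
Qed.

Section Step.
Variables (d : 'rV[R]_n.-1) (x v : 'rV[R]_n).
Hypotheses (dD : d \in @dist_set R n) (xS : x \in state_set a) (v0 : nonneg_inflow v).

Lemma state_ent i : in1n n i -> 0 < x#i <= a#i.
Proof. by move: xS; rewrite inE; apply. Qed.

Lemma flow_ent i : in1n n i -> 0 < f i (x#i) < x#i.
Proof. by move=> hi; apply: (fm_f_lt fm) => //; exact: state_ent. Qed.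

Lemma supply_ge0 i : in1n n i -> 0 <= supply a q c x i.
Proof.
move=> hi; rewrite /supply le_min ltW ?(fm_q fm) //=.
have /andP[c0 _] := fm_c fm hi; have /andP[_ xa] := state_ent hi.
by rewrite mulr_ge0 ?subr_ge0 // ltW.
Qed.

Lemma demand_gt0 i : (1 <= i < n)%N -> 0 < demand f P x i.
Proof.
move=> hi; have hi1 : in1n n.-1 i by rewrite /in1n; lia.
have hi2 : in1n n i by rewrite /in1n; lia.
have /andP[_ P1] := fm_P fm hi1; have /andP[f0 _] := flow_ent hi2.
by rewrite mulr_gt0 // subr_gt0.
Qed.

Lemma srv_spec i : (2 <= i <= n)%N ->
  let s := srv a q c f P d x v i in let D := demand f P x i.-1 in
  let m := supply a q c x i in
  [/\ 0 <= s <= 1, Num.min m (v#i + D) <= v#i + s * D,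
      Num.min D (m - v#i) <= s * D & v#i + D <= m -> s = 1].
Proof.
move=> hi /=; apply: share_spec.
- by move: dD; rewrite inE; apply.
- by apply: supply_ge0; rewrite /in1n; lia.
- by apply: v0; rewrite /in1n; lia.
- by apply: demand_gt0; lia.
Qed.

Lemma outflow_bounds i : in1n n i -> 0 <= outflow d x v i <= f i (x#i).
Proof.
move=> hi; rewrite /outflow; have /andP[f0 _] := flow_ent hi.
have [ei|i2] := eqVneq i n.
  have -> : f n (x#n) = f i (x#i) by rewrite ei.
  by rewrite lexx ltW.
have [] := @srv_spec i.+1 _; first by move: hi; rewrite /in1n; lia.
by move=> /andP[s0 s1] _ _ _; rewrite mulr_ge0 ?(ltW f0) //= ler_piMl // ltW.
Qed.

Lemma arrival_ge0 i : in1n n i -> 0 <= arrival x v i.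
Proof.
move=> hi; rewrite addr_ge0 ?v0 //; case: eqP => // i1.
by rewrite ltW // demand_gt0 //; move: hi; rewrite /in1n; lia.
Qed.

(** The content stays positive because [f i z < z], and below [a#i] because [c#i <= 1] limits the
    accepted inflow to the free room [a#i - x#i]. *)
Lemma Ftilde_state : Ftilde a q c f P d x v \in state_set a.
Proof.
rewrite inE => i hi; rewrite Ftilde_ent //.
have /andP[x0 xa] := state_ent hi; have /andP[f0 fx] := flow_ent hi.
have /andP[w0 w1] := outflow_bounds hi; have S0 := supply_ge0 hi.
have A0 := arrival_ge0 hi; have /andP[c0 c1] := fm_c fm hi.
have m0 : 0 <= Num.min (supply a q c x i) (arrival x v i) by rewrite le_min S0.
have m1 : Num.min (supply a q c x i) (arrival x v i) <= c#i * (a#i - x#i).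
  by rewrite ge_min /supply ge_min lexx orbT.
have : c#i * (a#i - x#i) <= a#i - x#i by rewrite ler_piMl // subr_ge0.
by move=> ?; apply/andP; split; lra.
Qed.

(** From the second clause of [srv_spec], whatever the priority: the part of the outflow that exits
    through the ramp can only help. *)
Lemma inflow_le i : (2 <= i <= n)%N ->
  Num.min (supply a q c x i) (arrival x v i) <= v#i + outflow d x v i.-1.
Proof.
move=> hi; have [_ h _ _] := srv_spec hi.
rewrite /arrival ifF; last by apply/eqP; lia.
apply: le_trans h _; rewrite lerD2l /outflow ifF; last by apply/eqP; lia.
rewrite prednK; last by lia.
have hi1 : in1n n.-1 i.-1 by rewrite /in1n; lia.
have /andP[P0 _] := fm_P fm hi1.
have /andP[f0 _] := @flow_ent i.-1 (ltac:(rewrite /in1n; lia)).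
have [/andP[s0 _] _ _ _] := srv_spec hi.
by rewrite /demand ler_wpM2l // ler_piMl ?(ltW f0) // gerBl.
Qed.

(* All that leaves cell [i] either enters cell [i + 1] or exits the freeway, so
   the content of the first [m] cells loses at least the outflow of cell [m]. *)
Lemma prefix_mass_step m : (1 <= m <= n)%N ->
  \sum_(1 <= i < m.+1) (Ftilde a q c f P d x v)#i <=
  \sum_(1 <= i < m.+1) x#i - outflow d x v m + \sum_(1 <= i < m.+1) v#i.
Proof.
elim: m => // m IH hm; have recr (F : nat -> R) :
    \sum_(1 <= i < m.+2) F i = \sum_(1 <= i < m.+1) F i + F m.+1.
  by rewrite big_nat_recr.
rewrite !recr [(Ftilde _ _ _ _ _ _ _ _)#(m.+1)](Ftilde_ent _ _ _ hm).
have [m0|m1] := posnP m.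
  rewrite m0 !big_geq //= !add0r lerD2l ge_min /arrival /= addr0 lexx orbT.
  by [].
have hm1 : (2 <= m.+1 <= n)%N by lia.
have := inflow_le hm1; have := IH ltac:(lia); rewrite /=; lra.
Qed.

(** Cell [i] has weight [n + 1 - i], so content that moves one cell downstream lowers the mass even
    if it does not leave the freeway. *)
Definition mass (y : 'rV[R]_n) : R := \sum_(1 <= m < n.+1) \sum_(1 <= i < m.+1) y#i.

Lemma mass_step i0 (eta : R) : in1n n i0 -> (forall i, in1n n i -> v#i <= eta) ->
  mass (Ftilde a q c f P d x v) <= mass x - outflow d x v i0 + eta *+ n ^ 2.
Proof.
move=> hi0 veta.
have eta0 : 0 <= eta by apply: le_trans (v0 hi0) (veta _ hi0).
have i0n : i0 \in index_iota 1 n.+1 by rewrite mem_index_iota ltnS.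
have oi0 : outflow d x v i0 <= \sum_(1 <= m < n.+1) outflow d x v m.
  rewrite (bigD1_seq i0) ?iota_uniq //= lerDl big_seq_cond sumr_ge0 // => i.
  rewrite mem_index_iota ltnS => /andP[hi _]; by case/andP: (outflow_bounds hi).
(* There are [n] prefixes, each with at most [n] inflows, whence [n ^ 2]. *)
have vsum : \sum_(1 <= m < n.+1) \sum_(1 <= i < m.+1) v#i <= eta *+ n ^ 2.
  have e2 : eta *+ n ^ 2 = \sum_(1 <= m < n.+1) eta *+ n.
    by rewrite sumr_const_nat subn1 /= -mulrnA.
  rewrite e2 big_nat [leRHS]big_nat; apply: ler_sum => m; rewrite ltnS => hm.
  apply: (@le_trans _ _ (\sum_(1 <= i < m.+1) eta)).
    rewrite big_nat [leRHS]big_nat; apply: ler_sum => i hi; apply: veta.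
    by rewrite /in1n; move: hm hi; clear; lia.
  rewrite sumr_const_nat subn1 /=; by apply: ler_wpMn2l => //; case/andP: hm.
have key : mass (Ftilde a q c f P d x v) <=
    \sum_(1 <= m < n.+1) (\sum_(1 <= i < m.+1) x#i - outflow d x v m
                          + \sum_(1 <= i < m.+1) v#i).
  rewrite /mass big_nat [leRHS]big_nat; apply: ler_sum => m; rewrite ltnS.
  exact: prefix_mass_step.
move: key; rewrite !big_split /= sumrN -/(mass x); lra.
Qed.

End Step.

(** The factor 2 leaves a supply of at least [k] to the upstream cell after a ramp inflow of at most
    [k]. *)
Definition drain_bound (mu : 'rV[R]_n) (k : R) := forall i, in1n n i ->
  k * 2 <= Num.min (q#i) (c#i * (a#i - mu#i)) /\
  forall z, mu#i <= z <= a#i -> k <= f i z.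

(** On [[mu, delta]] the flow is linear and hence at least [r * mu]; beyond [delta] it is at least
    [fmin]. The supply is positive since [mu < delta <= a]. *)
Lemma drain_bound_gt0 (mu : 'rV[R]_n) : (forall i, in1n n i -> 0 < mu#i < delta#i) ->
  exists2 k : R, 0 < k & drain_bound mu k.
Proof.
move=> hmu; apply: uniform_lower_bound => [i k k' _ kk' [h1 h2]|i hi].
  split; first by apply: le_trans h1; rewrite ler_pM2r.
  by move=> z hz; apply: le_trans kk' (h2 z hz).
have /andP[m0 md] := hmu i hi; have /andP[d0 da] := fm_delta fm hi.
have /andP[r0 _] := fm_r fm hi; have f0 := fm_fmin fm hi.
have q0 := fm_q fm hi; have /andP[c0 _] := fm_c fm hi.
have ca0 : 0 < c#i * (a#i - mu#i).
  by rewrite mulr_gt0 // subr_gt0; apply: lt_le_trans da.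
pose S := Num.min (q#i) (c#i * (a#i - mu#i)).
have S0 : 0 < S by rewrite lt_min q0.
exists (Num.min (S / 2) (Num.min (r#i * mu#i) (fmin#i))).
  by rewrite !lt_min divr_gt0 // f0 mulr_gt0.
split; first by rewrite -ler_pdivlMr // ge_min lexx.
move=> z /andP[mz za]; rewrite !ge_min.
have [zd|dz] := leP z (delta#i).
  rewrite (fm_f_lin fm) // ?zd ?andbT; last by apply: le_trans mz; apply: ltW.
  by rewrite ler_pM2l // mz orbT.
have /andP[h _] := fm_f_cong fm (z := z) hi (ltac:(by rewrite (ltW dz) za)).
by rewrite h !orbT.
Qed.

(* Take the last cell [i] outside the free-flow range: either it is the exit
   cell, or the next cell has spare supply, and its outflow is not small. *)
Lemma outflow_ge mu d x v k : d \in @dist_set R n -> x \in state_set a ->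
  nonneg_inflow v -> 0 < k -> drain_bound mu k -> x \notin Omega_set mu ->
  (forall i, in1n n i -> v#i <= k) ->
  exists2 i, in1n n i & k <= outflow d x v i.
Proof.
move=> dD xS v0 k0 hk xO vk.
pose bad i := in1n n i && (mu#i <= x#i).
have exbad : exists i, bad i.
  apply/not_existsP => nb; move/negP: xO; apply; rewrite inE => i hi.
  have /andP[-> _] := state_ent xS hi; rewrite ltNge; apply/negP => h.
  by apply: (nb i); rewrite /bad hi.
have bbad i : bad i -> (i <= n)%N by case/andP => /andP[].
case: (ex_maxnP exbad bbad) => i /andP[hi mx] imax.
have /andP[_ xa] := state_ent xS hi.
have [_ kf] := hk i hi; have {}kf : k <= f i (x#i) by apply: kf; rewrite mx.
exists i => //; rewrite /outflow.
have [ei|ni] := eqVneq i n.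
  by have -> : f n (x#n) = f i (x#i) by rewrite ei.
have hi1 : in1n n i.+1 by move: hi ni; rewrite /in1n; clear; lia.
have [_ _ hs _] := srv_spec dD xS v0 (i := i.+1) (ltac:(move: hi hi1; rewrite /in1n; clear; lia)).
have hiP : in1n n.-1 i by move: hi hi1; rewrite /in1n; clear; lia.
have /andP[P0 P1] := fm_P fm hiP.
have [S2 _] := hk _ hi1.
have xm : x#(i.+1) < mu#(i.+1).
  by rewrite ltNge; apply/negP => h; have := imax i.+1; rewrite /bad hi1 h ltnn => /(_ isT).
have S3 : k * 2 <= supply a q c x i.+1.
  apply: le_trans S2 _; rewrite le_min /supply !ge_min lexx /=.
  have /andP[c0 _] := fm_c fm hi1.
  by rewrite ler_wpM2l ?orbT ?(ltW c0) // lerD2l lerN2 ltW.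
have vk1 := vk _ hi1.
have /andP[f0 _] := flow_ent xS hi.
move: hs; rewrite /demand [i.+1.-1]/=; set s := srv _ _ _ _ _ _ _ _ _.
have [/andP[s0 s1] _ _ _] := srv_spec dD xS v0 (i := i.+1) (ltac:(move: hi hi1; rewrite /in1n; clear; lia)).
(* Either the whole demand is served, and the factor [1 - P#i] cancels, or the served flow is at
   least the supply left by the ramp, which is at least [k * 2 - k]. *)
rewrite -/s in s0 s1; rewrite minEle; case: ifP => _ h.
  apply: le_trans kf _; rewrite -(ler_pM2l (_ : 0 < 1 - P#i)) ?subr_gt0 //.
  by rewrite mulrCA.
have : s * ((1 - P#i) * f i (x#i)) <= s * f i (x#i).
  by rewrite ler_wpM2l // ler_piMl ?(ltW f0) // gerBl.
move: h; lra.
Qed.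

(** The condition of [bounds] on [vmax], for the actual inflows. For densities in [Omega_set mu] it
    makes every arrival fit into the supply. *)
Definition light_inflow (mu v : 'rV[R]_n) :=
  v#1 < Num.min (q#1) (c#1 * (a#1 - mu#1)) /\
  forall i, (2 <= i <= n)%N ->
    v#i + (1 - P#i.-1) * r#i.-1 * mu#i.-1 < Num.min (q#i) (c#i * (a#i - mu#i)).

(** * Free flow in [Omega] *)

Section FreeFlow.
Variables (mu : 'rV[R]_n) (d : 'rV[R]_n.-1) (x v : 'rV[R]_n).
Hypothesis hmu : forall i, in1n n i -> 0 < mu#i < delta#i.
Hypotheses (dD : d \in @dist_set R n) (xS : x \in state_set a) (v0 : nonneg_inflow v).
Hypotheses (xO : x \in Omega_set mu) (vl : light_inflow mu v).

Lemma free_flow i : in1n n i -> f i (x#i) = r#i * x#i.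
Proof.
move=> hi; have /andP[_ md] := hmu hi; move: xO; rewrite inE => /(_ i hi)/andP[x0 xm].
by rewrite (fm_f_lin fm) // (ltW x0) /= ltW // (lt_trans xm).
Qed.

Lemma free_supply i : in1n n i ->
  Num.min (q#i) (c#i * (a#i - mu#i)) <= supply a q c x i.
Proof.
move=> hi; move: xO; rewrite inE => /(_ i hi)/andP[x0 xm].
have /andP[c0 _] := fm_c fm hi; rewrite le_min /supply !ge_min lexx /=.
by rewrite ler_wpM2l ?orbT ?(ltW c0) // lerD2l lerN2 ltW.
Qed.

Lemma free_arrival i : in1n n i -> arrival x v i <= supply a q c x i.
Proof.
move=> hi; apply: le_trans (free_supply hi); rewrite /arrival.
have [v1 v2] := vl.
have [->|i1] := eqVneq i 1%N; first by rewrite addr0 ltW.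
have hi2 : (2 <= i <= n)%N by move: hi i1; rewrite /in1n; clear; lia.
have hi3 : in1n n i.-1 by move: hi2; rewrite /in1n; clear; lia.
have hi4 : in1n n.-1 i.-1 by move: hi2; rewrite /in1n; clear; lia.
apply: le_trans (ltW (v2 i hi2)); rewrite lerD2l /demand free_flow // mulrA.
have /andP[_ P1] := fm_P fm hi4; have /andP[r0 _] := fm_r fm hi3.
rewrite ler_wpM2l //; first by rewrite mulr_ge0 ?subr_ge0 ?(ltW r0) // ltW.
by move: xO; rewrite inE => /(_ _ hi3)/andP[_ /ltW].
Qed.

Lemma free_srv i : (2 <= i <= n)%N -> srv a q c f P d x v i = 1.
Proof.
move=> hi; have [_ _ _ h] := srv_spec dD xS v0 hi; apply: h.
have := @free_arrival i; rewrite /arrival ifF; last by apply/eqP; move: hi; clear; lia.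
by apply; rewrite /in1n; move: hi; clear; lia.
Qed.

Lemma free_outflow i : in1n n i -> outflow d x v i = r#i * x#i.
Proof.
move=> hi; rewrite /outflow; have [ei|ni] := eqVneq i n.
  have -> : f n (x#n) = f i (x#i) by rewrite ei.
  exact: free_flow.
rewrite free_srv ?mul1r ?free_flow //.
by move: hi ni; rewrite /in1n; clear; lia.
Qed.

(** Each minimum is attained by the arrival and each [s_i] is 1, so the step is affine and [d]
    disappears. *)
Lemma free_step i : in1n n i -> (Ftilde a q c f P d x v)#i =
  x#i - r#i * x#i
  + (v#i + (if i == 1%N then 0 else (1 - P#i.-1) * (r#i.-1 * x#i.-1))).
Proof.
move=> hi; rewrite Ftilde_ent // free_outflow // (min_idPr (free_arrival hi)).
rewrite /arrival; have [//|i1] := eqVneq i 1%N.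
rewrite /demand free_flow //; move: hi i1; rewrite /in1n; clear; lia.
Qed.

End FreeFlow.
End Freeway.

(** * The adaptive closed loop *)

Section Equilibrium.
Variables (R : realType) (n : nat) (P : 'rV[R]_n.-1) (v : 'rV[R]_n).

Lemma cumulS i : (1 <= i)%N ->
  cumul P v i.+1 = v#i.+1 + (1 - P#i) * cumul P v i.
Proof.
move=> i1; rewrite /cumul; congr (_ + _).
rewrite big_nat_recr //= big_nat1 [in RHS]mulrDr addrC [v#i * _]mulrC; congr (_ + _).
rewrite mulr_sumr big_nat [RHS]big_nat; apply: eq_bigr => j /andP[_ ji].
by rewrite big_nat_recr 1?ltnW //= mulrA mulrC.
Qed.

(** The fixed point equation of [free_step]: [cumul] is the flow through a cell, which equals its
    outflow [r * x]. *)
Lemma xeq_balance (r : 'rV[R]_n) i : in1n n i -> (forall i, in1n n i -> r#i != 0) ->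
  v#i + (if i == 1%N then 0 else (1 - P#i.-1) * (r#i.-1 * (xeq P r v)#i.-1))
  = r#i * (xeq P r v)#i.
Proof.
move=> hi r0; rewrite [in RHS]ent_vec // mulVKf ?r0 //.
have [->|i1] := eqVneq i 1%N; first by rewrite /cumul big_geq.
have hi1 : in1n n i.-1 by move: hi i1; rewrite /in1n; clear; lia.
rewrite ent_vec // mulVKf ?r0 //.
have ei : i = i.-1.+1 by move: hi i1; rewrite /in1n; clear; lia.
by rewrite [in RHS]ei cumulS -?ei //; case/andP: hi1.
Qed.

End Equilibrium.

(** * Clipping and intervals *)

Section ScalarEstimates.
Variable R : realType.

(** Clipping at a bound that the true value [y] respects brings no point further from [y]; this
    disposes of the saturations in controller and estimator. *)
Lemma dist_max (l x y : R) : l <= y -> `|Num.max l x - y| <= `|x - y|.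
Proof.
move=> ly; case: (leP l x) => // xl; rewrite ler0_norm ?subr_le0 // ler0_norm.
  by rewrite lerN2 lerD2r ltW.
by rewrite subr_le0 (le_trans (ltW xl)).
Qed.

Lemma dist_min (u x y : R) : y <= u -> `|Num.min u x - y| <= `|x - y|.
Proof.
move=> yu; case: (leP u x) => // ux; rewrite ger0_norm ?subr_ge0 // ger0_norm.
  by rewrite lerD2r.
by rewrite subr_ge0 (le_trans yu).
Qed.

Lemma dist_itv (k x y : R) : 0 <= x <= k -> 0 <= y <= k -> `|x - y| <= k.
Proof. by rewrite ler_norml; lra. Qed.

End ScalarEstimates.

(** * Inflows produced by the controller *)

Section ClosedLoop.
Variables (R : realType) (n : nat) (hn : (3 <= n)%N) (J : {set 'I_n}).
Variables (a q c : 'rV[R]_n) (f : nat -> R -> R) (delta r fmin : 'rV[R]_n) (P : 'rV[R]_n.-1).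
Variables (mu vs vmax b : 'rV[R]_n) (sigma eps tau : R) (g : param R J -> 'rV[R]_#|J|).
Hypothesis fm : freeway_model a q c f delta r fmin P.
Hypothesis bd : bounds a q c J delta r P vs mu vmax b sigma eps.
Hypothesis im : inflow_map vmax b eps P r vs g.
Hypothesis tau0 : 0 < tau.

Let th0 := true_param J P r vs.
Let xs := xeq P r vs.

(** The inflows that the plant receives: outside [J] the true ones enter, whatever [th] says about
    them. *)
Definition input (th : param R J) (x : 'rV[R]_n) : 'rV[R]_n :=
  joinvec (controller mu b sigma eps tau g th x) (subvec (~: J) vs).

Lemma input_ent th x i : in1n n i -> (input th x)#i =
  if i \in ix J then feedback b sigma tau (vfull g th) (xhat mu eps g th) x i else vs#i.
Proof.
move=> hi; case: ifP => iJ; rewrite /input.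
  by rewrite ent_joinvec_subvecl // ent_vec.
by rewrite ent_joinvec_subvecr // iJ.
Qed.

Lemma vfull_true : vfull g th0 = vs.
Proof. by rewrite /vfull (im_true im) joinvecK. Qed.

Lemma vfull_bounds th i : th \in Theta_set vmax eps -> in1n n i ->
  0 <= (vfull g th)#i <= vmax#i.
Proof.
move=> thT hi; have [iJ|iJ] := boolP (i \in ix J).
  have /andP[h1 ->] := im_range im thT iJ; rewrite andbT.
  have /andP[b0 _] := bd_b bd iJ; have /andP[e0 _] := bd_eps bd.
  by apply: le_trans h1; rewrite addr_ge0 // ltW.
have iJc : i \in ix (~: J) by rewrite mem_ixC.
rewrite /vfull ent_joinvec // (negbTE iJ) -(ent_subvec vmax iJc).
by move: thT; rewrite inE => -[_ h _]; apply: h; apply: index_ix.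
Qed.

Lemma vs_bounds i : in1n n i -> 0 <= vs#i <= vmax#i.
Proof.
move=> hi; have [->|i1] := eqVneq i 1%N.
  by have /andP[/ltW -> ->] := bd_vs1 bd.
by apply: (bd_vs bd); move: hi i1; rewrite /in1n; clear; lia.
Qed.

Lemma th0_Theta : th0 \in Theta_set vmax eps.
Proof.
rewrite inE; split => /= [i|k hk|i].
- exact: (bd_P bd).
- case/in1nP: hk => j ->; rewrite !entS /subvec !mxE -!entS; apply: vs_bounds.
  by apply/in1nP; exists (enum_val j).
- exact: (bd_r bd).
Qed.

Lemma congestion_ge0 (y x : 'rV[R]_n) : 0 <= congestion sigma y x.
Proof.
have /andP[s0 _] := bd_sigma bd.
by apply: sumr_ge0 => j _; rewrite mulr_ge0 ?exprn_ge0 ?(ltW s0) // le_max lexx.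
Qed.

(** Holds for every estimate: the congestion term only lowers the inflow, and the maximum keeps it
    above [b#i > 0]. *)
Lemma input_bounds th x i : th \in Theta_set vmax eps -> in1n n i ->
  0 <= (input th x)#i <= vmax#i.
Proof.
move=> thT hi; rewrite input_ent //; case: ifP => iJ; last exact: vs_bounds.
have /andP[b0 _] := bd_b bd iJ; have /andP[e0 _] := bd_eps bd.
have /andP[h1 h2] := im_range im thT iJ.
have bv : b#i <= (vfull g th)#i by apply: le_trans h1; rewrite lerDl ltW.
rewrite /feedback le_max (ltW b0) /= ge_max (le_trans bv h2) /=.
apply: le_trans h2; rewrite gerBl mulr_ge0 ?congestion_ge0 //.
by rewrite mulr_ge0 ?invr_ge0 ?(ltW tau0) // subr_ge0.
Qed.

Lemma input_nonneg th x : th \in Theta_set vmax eps -> nonneg_inflow (input th x).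
Proof. by move=> thT i hi; case/andP: (input_bounds x thT hi). Qed.

Lemma input_light th x : th \in Theta_set vmax eps ->
  light_inflow a q c r P mu (input th x).
Proof.
move=> thT; split.
  have h1 : in1n n 1 by rewrite /in1n; move: hn; clear; lia.
  by have /andP[_ h] := input_bounds x thT h1; apply: le_lt_trans h (bd_vmax1 bd).
move=> i hi; have h1 : in1n n i by rewrite /in1n; move: hi; clear; lia.
have /andP[_ h] := input_bounds x thT h1.
by apply: le_lt_trans (bd_vmaxi bd hi); rewrite lerD2r.
Qed.

Lemma xhat_le th i : in1n n i -> (xhat mu eps g th)#i <= mu#i - eps.
Proof. by move=> hi; rewrite ent_vec // ge_min lexx orbT. Qed.

Lemma xhat_true : xhat mu eps g th0 = xs.
Proof.
apply: ent_inj => i hi; rewrite ent_vec // vfull_true; apply/min_idPl.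
by case/andP: (bd_xs bd hi).
Qed.

Lemma input_true x : input th0 x = nominal_input J b sigma tau vs xs x.
Proof.
by apply: ent_inj => i hi; rewrite input_ent // ent_vec // vfull_true xhat_true.
Qed.

(** A cell outside the range of [Omega] exceeds its target by at least [eps], and
    [sigma ^ i >= sigma ^ n] as [sigma <= 1]. The clip in [xhat] ensures the hypothesis on [y] for
    every estimate. *)
Lemma congestion_ge (y x : 'rV[R]_n) : x \in state_set a -> x \notin Omega_set mu ->
  (forall i, in1n n i -> y#i <= mu#i - eps) -> sigma ^+ n * eps <= congestion sigma y x.
Proof.
move=> xS xO hy.
have [i hi mx] : exists2 i, in1n n i & mu#i <= x#i.
  apply: contrapT => nb; move/negP: xO; apply; rewrite inE => i hi.
  have /andP[-> _] := state_ent xS hi; rewrite ltNge; apply/negP => h.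
  by apply: nb; exists i.
have /andP[s0 s1] := bd_sigma bd; have /andP[e0 _] := bd_eps bd.
have i_in : i \in index_iota 1 n.+1 by rewrite mem_index_iota ltnS.
rewrite /congestion (bigD1_seq i) ?iota_uniq //= -[leLHS]addr0 lerD //; last first.
  by apply: sumr_ge0 => j _; rewrite mulr_ge0 ?exprn_ge0 ?(ltW s0) // le_max lexx.
apply: ler_pM; rewrite ?exprn_ge0 ?(ltW s0) ?(ltW e0) //.
  by apply: ler_wiXn2l; rewrite ?(ltW s0) //; case/andP: hi.
by rewrite le_max; apply/orP; right; have := hy i hi; lra.
Qed.

(* A small gain [tau] saturates the controller off the set [Omega]. *)
Lemma input_saturated th x i : tau <= sigma ^+ n * eps -> th \in Theta_set vmax eps ->
  x \in state_set a -> x \notin Omega_set mu -> i \in ix J -> (input th x)#i = b#i.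
Proof.
move=> htau thT xS xO iJ; rewrite input_ent ?(ix_in1n iJ) // iJ.
apply/max_idPl; have /andP[h1 _] := im_range im thT iJ.
have /andP[e0 _] := bd_eps bd.
have C1 := le_trans htau (congestion_ge xS xO (@xhat_le th)).
set v := (vfull g th)#i in h1 *; set C := congestion _ _ _ in C1 *.
have bv : 0 <= v - b#i by lra.
have t1 : 1 <= tau^-1 * C by rewrite mulrC ler_pdivlMr // mul1r.
rewrite mulrAC; nra.
Qed.

Lemma input_small eta th x : tau <= sigma ^+ n * eps ->
  (forall i, i \in ix J -> b#i <= eta) ->
  (forall i, i \in ix (~: J) -> vmax#i <= eta) ->
  th \in Theta_set vmax eps -> x \in state_set a -> x \notin Omega_set mu ->
  forall i, in1n n i -> (input th x)#i <= eta.
Proof.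
move=> htau hb hv thT xS xO i hi; have [iJ|iJ] := boolP (i \in ix J).
  by rewrite input_saturated // hb.
rewrite input_ent // (negbTE iJ); have /andP[_ h] := vs_bounds hi.
by apply: le_trans h (hv i _); rewrite mem_ixC.
Qed.

Lemma estimateE (x : 'rV[R]_n) (w : output R n) : estimate J vmax eps x w =
  (vec n.-1 (fun i => Num.min (1 - eps) (w.1.2#i / (w.1.2#i + w.2#i))),
   subvec (~: J) (vec n (fun i => Num.max 0 (Num.min (vmax#i)
     (if i == 1%N then x#1 - w.1.1#1 + w.2#1 + w.1.2#1
      else if i == n then x#n - w.1.1#n + w.1.2#n - w.2#n.-1
      else x#i - w.1.1#i + w.2#i + w.1.2#i - w.2#i.-1)))),
   vec n (fun i => Num.max eps (Num.min (1 - eps)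
     (if i == n then w.1.2#n / w.1.1#n else (w.1.2#i + w.2#i) / w.1.1#i)))).
Proof. by case: w => [[]]. Qed.

Lemma estimate_Theta x w : w \in active_set a mu -> estimate J vmax eps x w \in Theta_set vmax eps.
Proof.
rewrite !inE => -[]; rewrite inE => -[_ w2 w3] _ wpos.
have /andP[e0 e1] := bd_eps bd.
case: w w2 w3 wpos => [[w1 w2] w3] /= h2 h3 hpos; split => /= [i hi|k hk|i hi].
- have hi' : in1n n i by move: hi; rewrite /in1n; clear; lia.
  have p := hpos i hi; have /andP[p2 _] := h2 i hi'.
  rewrite ent_vec // ge_min lexx andbT le_min; apply/andP; split; first by lra.
  by rewrite divr_ge0 // ltW.
- case/in1nP: hk => j ->; rewrite !entS /subvec !mxE -!entS.
  have hj : in1n n (enum_val j).+1 by apply/in1nP; exists (enum_val j).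
  have := bd_vmax bd hj => v0.
  by rewrite le_max lexx ge_max ge_min lexx (ltW v0).
- rewrite ent_vec // le_max lexx ge_max ge_min lexx /= andbT; lra.
Qed.

(** * Measurements and exact identification *)

Section Measure.
Variables (d : 'rV[R]_n.-1) (th : param R J) (x : 'rV[R]_n).
Hypotheses (dD : d \in @dist_set R n) (thT : th \in Theta_set vmax eps)
  (xS : x \in state_set a).

Let v := input th x.
Let w := measure_out a q c f d th0 x (controller mu b sigma eps tau g th x).
Let o := outflow a q c f P d x v.

Lemma measure_ent1 : w.1.1 = x. Proof. by []. Qed.

Lemma measure_ent2 i : in1n n i -> w.1.2#i = if i == n then o n else P#i * o i.
Proof.
move=> hi; rewrite ent_vec // /o /outflow eqxx; case: eqP => // _.
by rewrite -mulrA.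
Qed.

Lemma measure_ent3 i : in1n n.-1 i -> w.2#i = (1 - P#i) * o i.
Proof.
move=> hi; rewrite ent_vec // /o /outflow -mulrA; case: eqP => // h.
by move: hi; rewrite h /in1n; move: hn; clear; lia.
Qed.

Lemma outflow_lt_a i : in1n n i -> 0 <= o i <= a#i.
Proof.
move=> hi; have /andP[q1 q2] := outflow_bounds hn fm dD xS (input_nonneg x thT) hi.
have /andP[_ f1] := flow_ent fm xS hi; have /andP[_ xa] := state_ent xS hi.
by rewrite q1 (le_trans q2) // (le_trans (ltW f1)).
Qed.

Lemma measure_output_set : w \in output_set a.
Proof.
rewrite inE; split => [//|i hi|i hi].
  rewrite measure_ent2 //; have /andP[q1 q2] := outflow_lt_a hi.
  case: eqP => [ei|ni].
    have -> : o n = o i by rewrite ei.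
    by rewrite q1.
  have hi' : in1n n.-1 i by move: hi ni; rewrite /in1n; clear; lia.
  have /andP[P0 P1] := fm_P fm hi'.
  by rewrite mulr_ge0 //= (le_trans _ q2) // ler_piMl // ltW.
rewrite measure_ent3 //; have hi' : in1n n i by move: hi; rewrite /in1n; clear; lia.
have /andP[q1 q2] := outflow_lt_a hi'; have /andP[P0 P1] := fm_P fm hi.
by rewrite mulr_ge0 ?subr_ge0 ?(ltW P1) //= (le_trans _ q2) // ler_piMl // gerBl.
Qed.

Hypothesis xO : x \in Omega_set mu.

Lemma Omega_outflow i : in1n n i -> o i = r#i * x#i.
Proof.
move=> hi; apply: (free_outflow hn fm (bd_mu bd) dD xS _ xO) => //.
  exact: input_nonneg.
exact: input_light.
Qed.

Lemma measure_active : w \in active_set a mu.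
Proof.
rewrite inE; split=> [||i hi]; [exact: measure_output_set|by []|].
have hi' : in1n n i by move: hi; rewrite /in1n; clear; lia.
rewrite measure_ent2 // measure_ent3 // ifF; last first.
  by apply/eqP; move: hi; rewrite /in1n; move: hn; clear; lia.
rewrite -mulrDl addrC subrK mul1r Omega_outflow //.
have /andP[r0 _] := fm_r fm hi'; have /andP[x0 _] := state_ent xS hi'.
exact: mulr_gt0.
Qed.

(** In free flow the two measured parts of the outflow add up to [r * x] and split it in the ratio
    [P : 1 - P]. All flows being measured, the inflow is the only unknown in the balance of one
    step. The clips leave the true values unchanged. *)
Lemma estimate_exact :
  estimate J vmax eps (Fbar a q c f d th0 x (controller mu b sigma eps tau g th x)) w = th0.
Proof.
have xi i : in1n n i -> 0 < r#i * x#i.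
  move=> hi; have /andP[r0 _] := fm_r fm hi; have /andP[x0 _] := state_ent xS hi.
  exact: mulr_gt0.
have wsum i : in1n n i -> i != n -> w.1.2#i + w.2#i = r#i * x#i.
  move=> hi ni; have hi' : in1n n.-1 i by move: hi ni; rewrite /in1n; clear; lia.
  rewrite measure_ent2 // (negbTE ni) measure_ent3 // -mulrDl addrC subrK mul1r.
  exact: Omega_outflow.
have w2n : w.1.2#n = r#n * x#n.
  have hi : in1n n n by rewrite /in1n; move: hn; clear; lia.
  by rewrite measure_ent2 // eqxx Omega_outflow.
have w3 i : in1n n.-1 i -> w.2#i = (1 - P#i) * (r#i * x#i).
  move=> hi; rewrite measure_ent3 // Omega_outflow //.
  by move: hi; rewrite /in1n; clear; lia.
have step i : in1n n i -> (Ftilde a q c f P d x v)#i = x#i - r#i * x#i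
  + (v#i + (if i == 1%N then 0 else (1 - P#i.-1) * (r#i.-1 * x#i.-1))).
  move=> hi; apply: (free_step hn fm (bd_mu bd) dD xS _ xO) => //.
    exact: input_nonneg.
  exact: input_light.
have w2 i : in1n n i -> i != n -> w.1.2#i = P#i * (r#i * x#i).
  by move=> hi ni; rewrite measure_ent2 // (negbTE ni) Omega_outflow.
have w1 : w.1.1 = x by exact: measure_ent1.
rewrite estimateE -[Fbar _ _ _ _ _ _ _ _]/(Ftilde a q c f P d x v).
clearbody w.
congr (_, _, _).
- apply: ent_inj => i hi; rewrite ent_vec //.
  have hi' : in1n n i by move: hi; rewrite /in1n; clear; lia.
  have ni : i != n by apply/eqP; move: hi; rewrite /in1n; move: hn; clear; lia.
  rewrite wsum // w2 // mulfK; last first.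
    by rewrite gt_eqF ?xi.
  by apply/min_idPr; case/andP: (bd_P bd hi).
- apply: eq_subvec => i iJ; have hi := ix_in1n iJ; rewrite ent_vec //.
  have vi : v#i = vs#i.
    by rewrite /v input_ent // ifF //; apply/negbTE; rewrite -mem_ixC.
  have /andP[v0 v1] := vs_bounds hi.
  set z := (X in Num.min _ X); suff -> : z = vs#i by rewrite (min_idPr v1) (max_idPr v0).
  rewrite {}/z w1.
  have [i1|i1] := eqVneq i 1%N.
    rewrite i1 in hi vi *; rewrite -vi step // -addrA [w.2#1 + _]addrC wsum //.
      by rewrite eqxx; ring.
    by apply/eqP; move: hn; clear; lia.
  have hi1 : in1n n.-1 i.-1 by move: hi i1; rewrite /in1n; clear; lia.
  have [ei|ni] := eqVneq i n.
    have -> : (Ftilde a q c f P d x v)#n - x#n + w.1.2#n - w.2#n.-1 =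
              (Ftilde a q c f P d x v)#i - x#i + w.1.2#n - w.2#i.-1 by rewrite ei.
    rewrite w2n step // (negbTE i1) w3 // vi.
    have -> : r#n * x#n = r#i * x#i by rewrite ei.
    by ring.
  rewrite -[_ + w.2#i + _]addrA [w.2#i + _]addrC wsum // step // (negbTE i1) w3 // vi.
  by ring.
- apply: ent_inj => i hi; rewrite ent_vec //.
  have /andP[r1 r2] := bd_r bd hi; have /andP[x0 _] := state_ent xS hi.
  set z := (X in Num.min _ X); suff -> : z = r#i by rewrite (min_idPr r2) (max_idPr r1).
  rewrite {}/z w1; have [ei|ni] := eqVneq i n.
    have -> : w.1.2#n / x#n = r#i * x#i / x#i by rewrite w2n ei.
    by rewrite mulfK // gt_eqF.
  by rewrite wsum // mulfK // gt_eqF.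
Qed.

End Measure.

Definition next_param (x : 'rV[R]_n) (w : output R n) (th : param R J) : param R J :=
  if w \in active_set a mu then estimate J vmax eps x w else th.

Lemma next_param_Theta x w th : th \in Theta_set vmax eps ->
  next_param x w th \in Theta_set vmax eps.
Proof. by rewrite /next_param; case: ifP => // wA _; apply: estimate_Theta. Qed.

(** * Solutions of the closed loop *)

Section Trajectory.
Variables (d : nat -> 'rV[R]_n.-1) (x : nat -> 'rV[R]_n) (w : nat -> output R n)
  (th : nat -> param R J).
Hypothesis sol : closed_loop_from a q c f mu vmax b sigma eps tau g th0 d x w th.

Lemma sol_dist t : d t \in @dist_set R n.
Proof. by case: sol => h _ _ _ _; apply: h. Qed.

Lemma sol_x t : x t.+1 = Ftilde a q c f P (d t) (x t) (input (th t) (x t)).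
Proof. by case: sol => _ _ _ _ /(_ t) []. Qed.

Lemma sol_w t : w t.+1 =
  measure_out a q c f (d t) th0 (x t) (controller mu b sigma eps tau g (th t) (x t)).
Proof. by case: sol => _ _ _ _ /(_ t) []. Qed.

Lemma sol_th t : th t.+1 = next_param (x t) (w t) (th t).
Proof. by case: sol => _ _ _ _ /(_ t) []. Qed.

Lemma sol_Theta t : th t \in Theta_set vmax eps.
Proof.
elim: t => [|t IH]; first by case: sol.
by rewrite sol_th; apply: next_param_Theta.
Qed.

Lemma sol_state t : x t \in state_set a.
Proof.
elim: t => [|t IH]; first by case: sol.
rewrite sol_x; apply: (Ftilde_state hn fm (sol_dist t) IH).
exact: input_nonneg (sol_Theta t).
Qed.

Lemma sol_output t : w t \in output_set a.
Proof.
case: t => [|t]; first by case: sol.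
by rewrite sol_w; apply: (measure_output_set (sol_dist t) (sol_Theta t) (sol_state t)).
Qed.

(** There are two steps of delay: the output at time [t] is stored in [w] at [t + 1] and enters the
    estimate at [t + 2]. *)
Lemma sol_exact t : x t \in Omega_set mu -> w t.+1 \in active_set a mu /\ th t.+2 = th0.
Proof.
move=> xO.
have wA : w t.+1 \in active_set a mu.
  by rewrite sol_w; apply: (measure_active (sol_dist t) (sol_Theta t) (sol_state t)).
split=> //; rewrite sol_th /next_param wA sol_w sol_x.
exact: (estimate_exact (sol_dist t) (sol_Theta t) (sol_state t)).
Qed.

(** Only [w] at time 0 is arbitrary; every later [w] is a true measurement, so the condition for an
    update is evidence about the actual state. *)
Lemma sol_exact_after t s : x t \in Omega_set mu -> th (t.+2 + s) = th0.
Proof.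
move=> xO; elim: s => [|s IH]; first by rewrite addn0; case: (sol_exact xO).
rewrite addnS addSn addSn; have [wA|wA] := boolP (w (t + s).+2 \in active_set a mu).
  (* The active [w] records the state one step earlier, which is therefore in [Omega]. *)
  apply: (sol_exact _).2; move: wA; rewrite sol_w inE => -[_ + _].
  by rewrite measure_ent1.
by rewrite sol_th /next_param (negbTE wA) -!addSn.
Qed.

Lemma sol_shift N s : (forall t, (N <= t)%N -> th t = th0) ->
  x (N + s).+1 = Ftilde a q c f P (d (N + s)) (x (N + s))
                   (nominal_input J b sigma tau vs xs (x (N + s))).
Proof. by move=> h; rewrite sol_x h ?leq_addr // input_true. Qed.

End Trajectory.

(** * Uniform hitting time of [Omega] *)

Section Hitting.
Variables (k eta : R).
Hypotheses (k0 : 0 < k) (hk : drain_bound a q c f mu k) (etak : eta <= k)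
  (eta_small : eta *+ n ^ 2 <= k / 2) (htau : tau <= sigma ^+ n * eps)
  (hb : forall i, i \in ix J -> b#i <= eta)
  (hv : forall i, i \in ix (~: J) -> vmax#i <= eta).

(** A loss of at least [k], of which the inflows give back at most half by the choice of [eta]. *)
Lemma mass_decrease d th x : d \in @dist_set R n -> th \in Theta_set vmax eps ->
  x \in state_set a -> x \notin Omega_set mu ->
  mass (Ftilde a q c f P d x (input th x)) <= mass x - k / 2.
Proof.
move=> dD thT xS xO.
have v0 := input_nonneg x thT.
have veta := input_small htau hb hv thT xS xO.
have [i hi ki] := outflow_ge hn fm dD xS v0 k0 hk xO
  (fun i hi => le_trans (veta i hi) etak).
have := mass_step hn fm dD xS v0 hi veta.
by move: ki eta_small; lra.
Qed.

Lemma mass_ge0 x : x \in state_set a -> 0 <= mass x.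
Proof.
move=> xS; rewrite /mass big_nat; apply: sumr_ge0 => m; rewrite ltnS => hm.
rewrite big_nat; apply: sumr_ge0 => i hi; apply: ltW.
by case/andP: (state_ent (i := i) xS (ltac:(move: hm hi; rewrite /in1n; clear; lia))).
Qed.

Lemma mass_le x : x \in state_set a -> mass x <= mass a.
Proof.
move=> xS; rewrite /mass big_nat [leRHS]big_nat; apply: ler_sum => m; rewrite ltnS => hm.
rewrite big_nat [leRHS]big_nat; apply: ler_sum => i hi.
by case/andP: (state_ent (i := i) xS (ltac:(move: hm hi; rewrite /in1n; clear; lia))).
Qed.

Lemma hitting_time : exists T : nat, forall d x w th,
  closed_loop_from a q c f mu vmax b sigma eps tau g th0 d x w th ->
  exists2 t, (t <= T)%N & x t \in Omega_set mu.
Proof.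
(* The mass starts at most at [mass a], stays nonnegative and loses [k / 2] per step outside
   [Omega]. *)
pose T := Num.bound (`|mass a| / (k / 2)).
have hT : mass a < k / 2 * T%:R.
  have k20 : 0 < k / 2 by rewrite divr_gt0.
  apply: le_lt_trans (ler_norm _) _; rewrite mulrC -ltr_pdivrMr //.
  by apply: archi_boundP; rewrite divr_ge0 // ltW.
exists T => d x w th sol; apply: contrapT => no.
have out t : (t <= T)%N -> x t \notin Omega_set mu.
  by move=> tT; apply/negP => xO; apply: no; exists t.
have dec t : (t <= T)%N -> mass (x t) <= mass a - k / 2 * t%:R.
  elim: t => [_|t IH tT]; first by rewrite mulr0 subr0; exact: mass_le (sol_state sol 0).
  have tT' := ltnW tT.
  have := mass_decrease (sol_dist sol t) (sol_Theta sol t) (sol_state sol t) (out t tT').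
  rewrite -(sol_x sol); have := IH tT'; rewrite -[t.+1%:R]natr1; lra.
have := dec T (leqnn T); have := mass_ge0 (sol_state sol T); move: hT; lra.
Qed.

Lemma settling_time : exists2 N : nat, (1 <= N)%N & forall d x w th,
  closed_loop_from a q c f mu vmax b sigma eps tau g th0 d x w th ->
  forall t, (N <= t)%N -> th t = th0.
Proof.
have [T hT] := hitting_time.
(* The hitting time plus the delay in [sol_exact]. *)
exists T.+2 => // d x w th sol t Tt; have [s sT xO] := hT _ _ _ _ sol.
have -> : t = (s.+2 + (t - s.+2))%N by move: sT Tt; clear; lia.
exact: (sol_exact_after sol).
Qed.

End Hitting.

(* The components of [\hat v^*] in [J] are left out, being functions of the others. *)
Record param_within (B : R) (th : param R J) : Prop := {
  pw_P : forall i, in1n n.-1 i -> `|(parP th)#i - P#i| <= B;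
  pw_r : forall i, in1n n i -> `|(parr th)#i - r#i| <= B;
  pw_v : forall i, i \in ix (~: J) -> `|(vfull g th)#i - vs#i| <= B }.

(** Entrywise errors under one radius suit linear arithmetic; [initial_within] and [total_error_le]
    convert from and to the Euclidean norms of 1). *)
Record state_within (B : R) (x : 'rV[R]_n) (w : output R n) (th : param R J) : Prop := {
  sw_x : forall i, in1n n i -> `|x#i - xs#i| <= B;
  sw_w1 : forall i, in1n n i -> `|w.1.1#i - xs#i| <= B;
  sw_w2 : forall i, in1n n i -> `|w.1.2#i - (yeq P r vs).1.2#i| <= B;
  sw_w3 : forall i, in1n n.-1 i -> `|w.2#i - (yeq P r vs).2#i| <= B;
  sw_th : param_within B th }.

(** * Lipschitz dependence of the inflows on the estimate *)

Lemma vfullC th i : i \in ix (~: J) -> (vfull g th)#i = (parv th)#((index i (ix (~: J))).+1).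
Proof.
move=> iJ; have hi := ix_in1n iJ; rewrite /vfull ent_joinvec //.
by move: iJ; rewrite mem_ixC // => /negbTE ->.
Qed.

Lemma param_dist B th : 0 <= B -> param_within B th -> `|th - th0| <= B.
Proof.
move=> B0 [hP hr hv]; rewrite prod_normE ge_max prod_normE ge_max.
apply/andP; split; [apply/andP; split|]; apply: rV_norm_le => // j; rewrite /= !mxE.
- by rewrite -!entS; apply: hP; apply/in1nP; exists j.
- have hj : (enum_val j).+1 \in ix (~: J) by rewrite mem_ixS enum_valP.
  have := hv _ hj; rewrite vfullC //.
  rewrite /ix index_map; last by move=> u v [] /val_inj.
  rewrite (enum_val_nth (enum_val j)) index_uniq ?enum_uniq -?cardE //.
  by rewrite -enum_val_nth /parv /subvec !entS.
- by rewrite -!entS; apply: hr; apply/in1nP; exists j.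
Qed.

(** [C1_lipschitz_at] gives a bound only within [rho] of the true parameters; for [B >= rho] the
    inflow error, at most [vmax#i], is at most [vmax#i / rho * B]. *)
Lemma vfull_lipschitz : exists2 C : R, 0 <= C & forall i, in1n n i ->
  forall B th, 0 <= B -> th \in Theta_set vmax eps -> param_within B th ->
  `|(vfull g th)#i - vs#i| <= C * B.
Proof.
have [h [hC hg]] := im_smooth im.
have [rho [C [rho0 C0 hL]]] := C1_lipschitz_at th0 (hC 1%N).
apply: uniform_upper_bound => [i k k' kk' hk B th B0 thT pw|i hi].
  by apply: le_trans (hk B th B0 thT pw) _; apply: ler_wpM2r.
have v0 : 0 < vmax#i := bd_vmax bd hi.
exists (1 + C + vmax#i / rho) => B th B0 thT pw.
have vr : 0 <= vmax#i / rho by rewrite divr_ge0 ?ltW.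
have [iJ|iJ] := boolP (i \in ix J); last first.
  have iJc : i \in ix (~: J) by rewrite mem_ixC.
  apply: le_trans (pw_v pw iJc) _; nra.
have [rB|Br] := leP rho B.
  have := dist_itv (vfull_bounds thT hi) (vs_bounds hi); move=> hd.
  have : vmax#i <= vmax#i / rho * B.
    by rewrite mulrAC ler_pdivlMr // ler_wpM2l // ltW.
  nra.
have hd := param_dist B0 pw.
have := hL th (le_lt_trans hd Br).
rewrite (hg th thT) (hg th0 th0_Theta) => hd2.
have : `|(vfull g th)#i - vs#i| <= `|g th - g th0|.
  rewrite -[in vs#i]vfull_true /vfull !ent_joinvec // iJ.
  have /in1nP[j ->] := index_ix iJ.
  rewrite !entS; have := rV_norm_ge (g th - g th0) j.
  by rewrite !mxE.
nra.
Qed.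

(** Induction along [cumulS]: the inherited error is multiplied by the estimate of [1 - P#i], which
    lies in [[0, 1]], and the error of [P#i] by the fixed true flow. *)
Lemma cumul_lipschitz i : in1n n i -> exists C : R,
  forall B th, 0 <= B -> th \in Theta_set vmax eps -> param_within B th ->
  `|cumul (parP th) (vfull g th) i - cumul P vs i| <= C * B.
Proof.
have [Cg Cg0 hg] := vfull_lipschitz.
elim: i => [//|i IH] hi.
have [i0|i0] := posnP i.
  by exists Cg => B th B0 thT pw; rewrite i0 in hi *; rewrite /cumul !big_geq // !addr0 hg.
have hi1 : in1n n i by move: hi i0; rewrite /in1n; clear; lia.
have hiP : in1n n.-1 i by move: hi i0; rewrite /in1n; clear; lia.
have [C hC] := IH hi1.
exists (Cg + C + `|cumul P vs i|) => B th B0 thT pw.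
rewrite !cumulS //.
have h1 := hg _ hi B th B0 thT pw; have h2 := hC B th B0 thT pw.
have h3 := pw_P pw hiP.
have /andP[P0 P1] : 0 <= (parP th)#i <= 1 - eps.
  by move: thT; rewrite inE => -[+ _ _]; apply.
have /andP[e0 _] := bd_eps bd.
set vh := (vfull g th)#i.+1 in h1 *; set v := vs#i.+1 in h1 *.
set ch := cumul (parP th) _ i in h2 *; set c0 := cumul P vs i in h2 *.
set Ph := (parP th)#i in h3 P0 P1 *.
have -> : vh + (1 - Ph) * ch - (v + (1 - P#i) * c0) =
  (vh - v) + (1 - Ph) * (ch - c0) - (Ph - P#i) * c0 by ring.
apply: le_trans (ler_normB _ _) _; rewrite [leRHS]mulrDl lerD //.
  apply: le_trans (ler_normD _ _) _; rewrite [leRHS]mulrDl lerD // normrM.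
  have : `|1 - Ph| <= 1 by rewrite ger0_norm; lra.
  by have := normr_ge0 (ch - c0); nra.
by rewrite normrM mulrC ler_wpM2l.
Qed.

(** The estimate of [r#i] is at least [eps], so dividing by it costs a factor [eps^-1], and the clip
    at [mu#i - eps] respects [xs#i]. *)
Lemma xhat_lipschitz : exists2 C : R, 0 <= C & forall i, in1n n i ->
  forall B th, 0 <= B -> th \in Theta_set vmax eps -> param_within B th ->
  `|(xhat mu eps g th)#i - xs#i| <= C * B.
Proof.
apply: uniform_upper_bound => [i k k' kk' hk B th B0 thT pw|i hi].
  by apply: le_trans (hk B th B0 thT pw) _; apply: ler_wpM2r.
have [C hC] := cumul_lipschitz hi.
have /andP[e0 _] := bd_eps bd.
exists (eps^-1 * (C + `|xs#i|)) => B th B0 thT pw.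
have xle : xs#i <= mu#i - eps by case/andP: (bd_xs bd hi).
rewrite [(xhat _ _ _ _)#i]ent_vec // minC; apply: le_trans (dist_min _ xle) _.
have /andP[r0 _] := bd_r bd hi.
have /andP[rh0 _] : eps <= (parr th)#i <= 1 - eps.
  by move: thT; rewrite inE => -[_ _]; apply.
have h1 := hC B th B0 thT pw; have h2 := pw_r pw hi.
have exs : cumul P vs i = r#i * xs#i.
  by rewrite /xs ent_vec // mulVKf // gt_eqF // (lt_le_trans e0).
rewrite [(xeq (parP th) _ _)#i]ent_vec //; rewrite exs in h1.
set ch := cumul (parP th) _ i in h1 *; set rh := (parr th)#i in rh0 h2 *.
have rh1 : 0 < rh := lt_le_trans e0 rh0.
have -> : rh^-1 * ch - xs#i = rh^-1 * ((ch - r#i * xs#i) - (rh - r#i) * xs#i).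
  by field; rewrite gt_eqF.
rewrite normrM -mulrA ler_pM //.
  by rewrite ger0_norm ?invr_ge0 ?(ltW rh1) // lef_pV2 ?posrE.
apply: le_trans (ler_normB _ _) _; rewrite [leRHS]mulrDl lerD //.
by rewrite normrM mulrC ler_wpM2l.
Qed.

Lemma input_lipschitz : exists2 C : R, 0 <= C & forall i, in1n n i ->
  forall B th x, 0 <= B -> th \in Theta_set vmax eps -> param_within B th ->
  (forall i, in1n n i -> `|x#i - xs#i| <= B) ->
  `|(input th x)#i - vs#i| <= C * B.
Proof.
have [Cg Cg0 hg] := vfull_lipschitz; have [Cx Cx0 hx] := xhat_lipschitz.
apply: uniform_upper_bound => [i k k' kk' hk B th x B0 thT pw hB|i hi].
  by apply: le_trans (hk B th x B0 thT pw hB) _; apply: ler_wpM2r.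
have v0 : 0 < vmax#i := bd_vmax bd hi.
(* The gain is at most [tau^-1 * vmax#i], and each of the [n] terms of the congestion is at most the
   error of [x] plus that of [xhat], that is, [(1 + Cx) * B]. *)
pose K := tau^-1 * vmax#i * ((1 + Cx) * n%:R).
have K0 : 0 <= K by rewrite !mulr_ge0 ?invr_ge0 ?(ltW tau0) ?(ltW v0) // addr_ge0.
exists (Cg + K) => B th x B0 thT pw hB.
rewrite input_ent //; case: ifP => iJ; last first.
  by rewrite subrr normr0 mulr_ge0 // addr_ge0.
have /andP[s0 s1] := bd_sigma bd.
have Xi : congestion sigma (xhat mu eps g th) x <= (1 + Cx) * n%:R * B.
  have -> : (1 + Cx) * n%:R * B = \sum_(1 <= j < n.+1) ((1 + Cx) * B).
    by rewrite sumr_const_nat subn1 /= -mulr_natr; ring.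
  rewrite /congestion big_nat [leRHS]big_nat; apply: ler_sum => j; rewrite ltnS => hj.
  have h1 := hB j hj; have h2 := hx j hj B th B0 thT pw.
  apply: (@le_trans _ _ `|x#j - (xhat mu eps g th)#j|).
    rewrite -[leRHS]mul1r ler_pM ?exprn_ge0 ?(ltW s0) ?le_max ?lexx //.
      by rewrite exprn_ile1 // ltW.
    by rewrite ge_max normr_ge0 ler_norm.
  rewrite -(subrKA xs#j) [leRHS]mulrDl mul1r (le_trans (ler_normD _ _)) // lerD //.
  by rewrite distrC.
have C0 := congestion_ge0 (xhat mu eps g th) x.
set Z := congestion _ _ _ in Xi C0 *.
have /andP[b0 bv] := bd_b bd iJ.
have /andP[h1 h2] := im_range im thT iJ; have /andP[e0 _] := bd_eps bd.
have h3 := hg i hi B th B0 thT pw.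
rewrite /feedback -/Z; apply: le_trans (dist_max _ (ltW bv)) _.
set vh := (vfull g th)#i in h1 h2 h3 *.
have -> : vh - tau^-1 * (vh - b#i) * Z - vs#i = (vh - vs#i) - tau^-1 * (vh - b#i) * Z by ring.
apply: le_trans (ler_normB _ _) _; rewrite [leRHS]mulrDl lerD //.
have vb : 0 <= vh - b#i by lra.
have t0 : 0 <= tau^-1 by rewrite invr_ge0 ltW.
rewrite ger0_norm ?mulr_ge0 // /K -[leRHS]mulrA ler_pM ?mulr_ge0 //.
by rewrite ler_wpM2l //; lra.
Qed.

Lemma xs_pos i : in1n n i -> 0 < xs#i.
Proof. by move=> hi; case/andP: (bd_xs bd hi). Qed.

Lemma xs_lt_a i : in1n n i -> xs#i < a#i.
Proof.
move=> hi; have /andP[_ h] := bd_xs bd hi; have /andP[_ md] := bd_mu bd hi.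
have /andP[_ da] := fm_delta fm hi; have /andP[e0 _] := bd_eps bd.
rewrite -/xs in h; lra.
Qed.

(** With the factor 2, states within [rho] of [xs] stay below [mu]; with the factor 4, the measured
    outflow [w2 + w3], whose error is at most [2 * rho], stays above [rho * 2]. *)
Lemma near_radius : exists2 rho : R, 0 < rho &
  forall i, in1n n i -> rho * 2 <= eps /\ rho * 4 <= r#i * xs#i.
Proof.
apply: uniform_lower_bound => [i k k' _ kk' [h1 h2]|i hi]; first by split; lra.
have /andP[e0 _] := bd_eps bd; have /andP[r0 _] := fm_r fm hi.
have rx : 0 < r#i * xs#i by rewrite mulr_gt0 ?xs_pos.
exists (Num.min (eps / 2) (r#i * xs#i / 4)).
  by rewrite lt_min !divr_gt0.
by split; rewrite -ler_pdivlMr // ge_min lexx ?orbT.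
Qed.

Lemma yeq_ent2 i : in1n n i ->
  (yeq P r vs).1.2#i = if i == n then r#i * xs#i else P#i * (r#i * xs#i).
Proof.
move=> hi; rewrite ent_vec //; case: eqP => [ei|_]; last by rewrite mulrA.
by rewrite -/xs ei.
Qed.

Lemma yeq_ent3 i : in1n n.-1 i -> (yeq P r vs).2#i = (1 - P#i) * (r#i * xs#i).
Proof. by move=> hi; rewrite ent_vec // mulrA. Qed.

(** * One step near the equilibrium *)

Section Step.
Variables (d : 'rV[R]_n.-1) (x : 'rV[R]_n) (w : output R n) (th : param R J).
Hypotheses (dD : d \in @dist_set R n) (xS : x \in state_set a)
  (wY : w \in output_set a) (thT : th \in Theta_set vmax eps).

Let x' := Ftilde a q c f P d x (input th x).
Let w' := measure_out a q c f d th0 x (controller mu b sigma eps tau g th x).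
Let th' := next_param x w th.

Section Near.
Variables (rho Cu B : R).
Hypotheses (rho0 : 0 < rho) (Cu0 : 0 <= Cu) (B0 : 0 <= B) (Brho : B <= rho).
Hypothesis hrho : forall i, in1n n i -> rho * 2 <= eps /\ rho * 4 <= r#i * xs#i.
Hypothesis near : state_within B x w th.
Hypothesis inC : forall i, in1n n i -> `|(input th x)#i - vs#i| <= Cu * B.

Lemma near_Omega (z : 'rV[R]_n) : (forall i, in1n n i -> `|z#i - xs#i| <= B) ->
  z \in Omega_set mu.
Proof.
move=> hz; rewrite inE => i hi; have := hz i hi; rewrite ler_norml => /andP[z1 z2].
have [h1 h2] := hrho hi; have /andP[_ xm] := bd_xs bd hi; rewrite -/xs in xm.
have /andP[r0 r1] := fm_r fm hi; have x0 := xs_pos hi.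
have rx : r#i * xs#i <= xs#i by rewrite ler_piMl ?(ltW x0) // ltW.
by move: z1 z2 h1 h2 xm rx Brho rho0; lra.
Qed.

(** Subtracting [xeq_balance] from [free_step] leaves three errors: that of the cell itself, that of
    the upstream cell and that of the inflow. *)
Lemma near_step_x i : in1n n i -> `|x'#i - xs#i| <= (2 + Cu) * B.
Proof.
move=> hi; have xO := near_Omega (sw_x near).
have -> : x'#i = x#i - r#i * x#i + ((input th x)#i
    + (if i == 1%N then 0 else (1 - P#i.-1) * (r#i.-1 * x#i.-1))).
  apply: (free_step hn fm (bd_mu bd) dD xS _ xO) => //; first exact: input_nonneg.
  exact: input_light.
have bal := @xeq_balance _ _ P vs r i hi (fun i hi => lt0r_neq0 (proj1 (andP (fm_r fm hi)))).
rewrite -/xs in bal.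
have hx := sw_x near hi; have hv := inC hi; have /andP[r0 r1] := fm_r fm hi.
have A1 : `|(1 - r#i) * (x#i - xs#i)| <= B.
  rewrite normrM ger0_norm ?subr_ge0 ?(ltW r1) //.
  by apply: le_trans hx; rewrite ler_piMl // gerBl ltW.
have A2 : `|(if i == 1%N then 0 else (1 - P#i.-1) * (r#i.-1 * x#i.-1))
   - (if i == 1%N then 0 else (1 - P#i.-1) * (r#i.-1 * xs#i.-1))| <= B.
  have [_|i1] := eqVneq i 1%N; first by rewrite subrr normr0.
  have hi1 : in1n n i.-1 by move: hi i1; rewrite /in1n; clear; lia.
  have hiP : in1n n.-1 i.-1 by move: hi i1; rewrite /in1n; clear; lia.
  have /andP[P0 P1] := fm_P fm hiP; have /andP[s0 s1] := fm_r fm hi1.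
  rewrite -mulrBr -mulrBr !normrM (ger0_norm (_ : 0 <= 1 - _)) ?subr_ge0 ?(ltW P1) //.
  rewrite (ger0_norm (ltW s0)); have := sw_x near hi1.
  set e := `|_| => he; have e0 : 0 <= e by apply: normr_ge0.
  apply: le_trans he; rewrite mulrA ler_piMl //.
  by rewrite mulr_ile1 ?subr_ge0 ?gerBl // ltW.
set y := (if _ then _ else _) in A2 *; set z := (if _ then _ else _) in bal A2.
have -> : x#i - r#i * x#i + ((input th x)#i + y) - xs#i =
   (1 - r#i) * (x#i - xs#i) + ((input th x)#i - vs#i) + (y - z).
  have -> : vs#i = r#i * xs#i - z by rewrite -bal addrK.
  by ring.
have := ler_normD ((1 - r#i) * (x#i - xs#i) + ((input th x)#i - vs#i)) (y - z).
have := ler_normD ((1 - r#i) * (x#i - xs#i)) ((input th x)#i - vs#i).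
by move: A1 A2 hv; lra.
Qed.

Lemma near_outflow i : in1n n i ->
  `|outflow a q c f P d x (input th x) i - r#i * xs#i| <= B.
Proof.
move=> hi; have xO := near_Omega (sw_x near).
rewrite Omega_outflow // -mulrBr normrM; have /andP[r0 r1] := fm_r fm hi.
rewrite (ger0_norm (ltW r0)); apply: le_trans (sw_x near hi).
by rewrite ler_piMl // ltW.
Qed.

Lemma near_step_w2 i : in1n n i -> `|w'.1.2#i - (yeq P r vs).1.2#i| <= B.
Proof.
move=> hi; rewrite yeq_ent2 // /w' measure_ent2 //; have h := near_outflow hi.
case: eqP => [ei|ni]; first by move: h; rewrite {1}ei.
have hi' : in1n n.-1 i by move: hi ni; rewrite /in1n; clear; lia.
have /andP[P0 P1] := fm_P fm hi'.
rewrite -mulrBr normrM (ger0_norm P0); apply: le_trans h.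
by rewrite ler_piMl // ltW.
Qed.

Lemma near_step_w3 i : in1n n.-1 i -> `|w'.2#i - (yeq P r vs).2#i| <= B.
Proof.
move=> hi; rewrite yeq_ent3 // /w' measure_ent3 //.
have hi' : in1n n i by move: hi; rewrite /in1n; clear; lia.
have h := near_outflow hi'; have /andP[P0 P1] := fm_P fm hi.
rewrite -mulrBr normrM ger0_norm ?subr_ge0 ?(ltW P1) //; apply: le_trans h.
by rewrite ler_piMl // gerBl.
Qed.

Lemma near_flow i : in1n n.-1 i -> rho * 2 <= w.1.2#i + w.2#i.
Proof.
move=> hi; have hi' : in1n n i by move: hi; rewrite /in1n; clear; lia.
have := sw_w2 near hi'; have := sw_w3 near hi.
rewrite yeq_ent2 // yeq_ent3 // ifF; last first.
  by apply/eqP; move: hi; rewrite /in1n; move: hn; clear; lia.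
rewrite !ler_norml => /andP[h1 _] /andP[h2 _].
by have [_ h3] := hrho hi'; move: h1 h2 h3 Brho; lra.
Qed.

(** So close to the equilibrium the estimate is always updated, and its jump at the boundary of
    [active_set] is not met. *)
Lemma near_active : w \in active_set a mu.
Proof.
rewrite inE; split=> // [|i hi]; first exact: near_Omega (sw_w1 near).
by apply: lt_le_trans (near_flow hi); rewrite mulr_gt0.
Qed.

(** [4 * B] covers the numerators of all quotients in [near_step_th]. *)
Lemma near_quot (y z : R) : rho * 2 <= y -> `|z| <= 4 * B -> `|z / y| <= 2 / rho * B.
Proof.
move=> ry hz; have y0 : 0 < y by apply: lt_le_trans ry; rewrite mulr_gt0.
rewrite normrM normfV (gtr0_norm y0) ler_pdivrMr //; apply: le_trans hz _.
have -> : 4 * B = 2 / rho * B * (rho * 2) by field; rewrite gt_eqF.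
by rewrite ler_wpM2l // !mulr_ge0 ?invr_ge0 // ltW.
Qed.

(** [2 / rho] stems from the quotients that estimate [P] and [r], and 5 from the inflow estimates,
    which combine at most five quantities with an error of at most [B] each. *)
Lemma near_step_th : param_within ((5 + 2 / rho) * B) th'.
Proof.
have rB : 0 <= 2 / rho * B by rewrite !mulr_ge0 ?invr_ge0 ?(ltW rho0).
rewrite /th' /next_param near_active estimateE.
have w3 i : in1n n.-1 i -> `|w.2#i - (1 - P#i) * (r#i * xs#i)| <= B.
  by move=> hi; rewrite -yeq_ent3 //; apply: sw_w3 near i hi.
have w2 i : in1n n i -> `|w.1.2#i - (if i == n then r#i * xs#i else P#i * (r#i * xs#i))| <= B.
  by move=> hi; rewrite -yeq_ent2 //; apply: sw_w2 near i hi.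
have w1 i : in1n n i -> `|w.1.1#i - xs#i| <= B by apply: sw_w1 near i.
have hx i : in1n n i -> `|x#i - xs#i| <= B by apply: sw_x near i.
have w1pos i : in1n n i -> rho * 2 <= w.1.1#i.
  move=> hi; have := w1 i hi; have /andP[r0 r1] := fm_r fm hi.
  have rx : r#i * xs#i <= xs#i by rewrite ler_piMl ?(ltW (xs_pos hi)) // ltW.
  have [_ h] := hrho hi; rewrite ler_norml => /andP[h1 _].
  by move: h1 h rx Brho rho0; lra.
split=> [i hi|i hi|i iJ]; rewrite ?[parP _]/= ?[parr _]/=.
- have hi' : in1n n i by move: hi; rewrite /in1n; clear; lia.
  have ni : (i == n) = false by apply/eqP; move: hi; rewrite /in1n; move: hn; clear; lia.
  rewrite ent_vec //; have /andP[P0 P1] := bd_P bd hi.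
  have /andP[_ P2] := fm_P fm hi.
  apply: le_trans (dist_min _ P1) _.
  have h1 := near_flow hi; have h2 := w2 i hi'; have h3 := w3 i hi; rewrite ni in h2.
  have y0 : 0 < w.1.2#i + w.2#i by apply: lt_le_trans h1; rewrite mulr_gt0.
  (* The numerator [(1 - P) w2 - P w3] vanishes at the equilibrium, so it can be written in the
     errors of [w2] and [w3]. *)
  have -> : w.1.2#i / (w.1.2#i + w.2#i) - P#i =
     ((1 - P#i) * (w.1.2#i - P#i * (r#i * xs#i))
       - P#i * (w.2#i - (1 - P#i) * (r#i * xs#i))) / (w.1.2#i + w.2#i).
    by field; rewrite gt_eqF.
  apply: le_trans (near_quot h1 (_ : _ <= 4 * B)) _; last by rewrite [leRHS]mulrDl lerDr mulr_ge0.
  apply: le_trans (ler_normB _ _) _; rewrite !normrM (ger0_norm P0).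
  rewrite ger0_norm ?subr_ge0 ?(ltW P2) //.
  move: h2 h3 P0 P2; set e1 := `|_|; set e2 := `|_| => h2 h3 P0 P2.
  have e10 : 0 <= e1 by apply: normr_ge0.
  have e20 : 0 <= e2 by apply: normr_ge0.
  by nra.
- rewrite ent_vec //; have /andP[r1 r2] := bd_r bd hi.
  apply: le_trans (dist_max _ r1) _.
  apply: le_trans (dist_min _ r2) _.
  have h1 := w1pos i hi; have h2 := w1 i hi; have h3 := w2 i hi.
  have y0 : 0 < w.1.1#i by apply: lt_le_trans h1; rewrite mulr_gt0.
  have /andP[r0 r3] := fm_r fm hi.
  have rw : `|r#i * (w.1.1#i - xs#i)| <= B.
    rewrite normrM (gtr0_norm r0); apply: le_trans h2; by rewrite ler_piMl // ltW.
  case: ifP h3 => [/eqP ei|ni] h3.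
    have -> : w.1.2#n / w.1.1#n - r#i = ((w.1.2#i - r#i * xs#i)
          - r#i * (w.1.1#i - xs#i)) / w.1.1#i.
      have -> : w.1.2#n / w.1.1#n = w.1.2#i / w.1.1#i by rewrite ei.
      by field; rewrite gt_eqF.
    apply: le_trans (near_quot h1 (_ : _ <= 4 * B)) _; last by rewrite [leRHS]mulrDl lerDr mulr_ge0.
    apply: le_trans (ler_normB _ _) _; move: h3 rw B0; lra.
  have hi' : in1n n.-1 i by move: hi ni; rewrite /in1n; clear; lia.
  have h4 := w3 i hi'.
  have -> : (w.1.2#i + w.2#i) / w.1.1#i - r#i = ((w.1.2#i - P#i * (r#i * xs#i))
     + (w.2#i - (1 - P#i) * (r#i * xs#i)) - r#i * (w.1.1#i - xs#i)) / w.1.1#i.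
    by field; rewrite gt_eqF.
  apply: le_trans (near_quot h1 (_ : _ <= 4 * B)) _; last by rewrite [leRHS]mulrDl lerDr mulr_ge0.
  apply: le_trans (ler_normB _ _) _.
  have := ler_normD (w.1.2#i - P#i * (r#i * xs#i)) (w.2#i - (1 - P#i) * (r#i * xs#i)).
  by move: h3 h4 rw B0; lra.
have hi := ix_in1n iJ; have iJ' : i \notin ix J by rewrite -mem_ixC.
rewrite /vfull [parv _]/= ent_joinvec_subvecr // ent_vec //.
have /andP[v0 v1] := vs_bounds hi.
apply: le_trans (dist_max _ v0) _; apply: le_trans (dist_min _ v1) _.
suff : `|(if i == 1%N then x#1 - w.1.1#1 + w.2#1 + w.1.2#1
      else if i == n then x#n - w.1.1#n + w.1.2#n - w.2#n.-1
      else x#i - w.1.1#i + w.2#i + w.1.2#i - w.2#i.-1) - vs#i| <= 5 * B.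
  by move=> h; apply: le_trans h _; rewrite [leRHS]mulrDl lerDl.
(* By this balance the estimating expression equals [vs#i] at the equilibrium, so only the errors of
   its terms remain. *)
have bal := @xeq_balance _ _ P vs r i hi (fun i hi => lt0r_neq0 (proj1 (andP (fm_r fm hi)))).
rewrite -/xs in bal.
have h1 := w1 i hi; have h2 := w2 i hi; have h3 := hx i hi.
have [i1|i1] := eqVneq i 1%N.
  have hi' : in1n n.-1 i by rewrite i1 /in1n; move: hn; clear; lia.
  have ni : (i == n) = false by apply/eqP; move: i1 hn; clear; lia.
  rewrite ni in h2; have h4 := w3 i hi'.
  rewrite i1 eqxx in h1 h2 h3 h4 bal *.
  move: h1 h2 h3 h4; rewrite !ler_norml; move: bal B0; lra.
have hi1 : in1n n.-1 i.-1 by move: hi i1; rewrite /in1n; clear; lia.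
have h4 := w3 _ hi1; rewrite (negbTE i1) in bal.
have [ei|ni] := eqVneq i n.
  have -> : x#n - w.1.1#n + w.1.2#n - w.2#n.-1 = x#i - w.1.1#i + w.1.2#i - w.2#i.-1 by rewrite ei.
  have ein : i == n by apply/eqP.
  rewrite ein in h2.
  move: h1 h2 h3 h4; rewrite !ler_norml; move: bal B0; lra.
rewrite (negbTE ni) in h2.
have hi' : in1n n.-1 i by move: hi ni; rewrite /in1n; clear; lia.
have h5 := w3 _ hi'.
move: h1 h2 h3 h4 h5; rewrite !ler_norml; move: bal B0; lra.
Qed.

End Near.
End Step.

Lemma param_withinW B B' th : B <= B' -> param_within B th -> param_within B' th.
Proof.
by move=> BB' [h1 h2 h3]; split=> i hi; apply: le_trans BB'; [apply: h1|apply: h2|apply: h3].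
Qed.

Lemma state_withinW B B' x w th : B <= B' ->
  state_within B x w th -> state_within B' x w th.
Proof.
move=> BB' [h1 h2 h3 h4 h5]; split; last exact: param_withinW h5.
all: by move=> i hi; apply: le_trans BB'; [apply: h1 || apply: h2 || apply: h3 || apply: h4].
Qed.

Lemma state_within_bounded : exists2 K : R, 0 <= K &
  forall x w th, x \in state_set a -> w \in output_set a -> th \in Theta_set vmax eps ->
  state_within K x w th.
Proof.
have [K K0 hK] : exists2 K : R, 0 <= K &
    forall i, in1n n i -> [/\ a#i <= K, vmax#i <= K & 1 <= K].
  apply: uniform_upper_bound => [i k k' kk' [h1 h2 h3]|i hi].
    by split; apply: le_trans kk'.
  by exists (Num.max (a#i) (Num.max (vmax#i) 1)); rewrite !le_max !lexx !orbT.
have bdK (m y z : R) : m <= K -> 0 <= y <= m -> 0 <= z <= m -> `|y - z| <= K.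
  by move=> mK hy hz; apply: le_trans (dist_itv hy hz) mK.
have e0 : 0 < eps by case/andP: (bd_eps bd).
have xsa i : in1n n i -> 0 <= xs#i <= a#i.
  by move=> hi; rewrite !ltW ?xs_pos ?xs_lt_a.
have rxa i : in1n n i -> 0 <= r#i * xs#i <= a#i.
  move=> hi; have /andP[r0 r1] := fm_r fm hi; have /andP[x0 xa] := xsa i hi.
  by rewrite mulr_ge0 ?(ltW r0) //= (le_trans _ xa) // ler_piMl // ltW.
exists K => // x w th xS wY thT.
move: (wY); rewrite inE => -[wS w2 w3].
move: (thT); rewrite inE => -[tP _ tr].
have xa z : z \in state_set a -> forall i, in1n n i -> 0 <= z#i <= a#i.
  by move=> zS i hi; have /andP[/ltW -> ->] := state_ent zS hi.
split=> [i hi|i hi|i hi|i hi|].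
- by have [aK _ _] := hK i hi; apply: bdK aK (xa _ xS i hi) (xsa i hi).
- by have [aK _ _] := hK i hi; apply: bdK aK (xa _ wS i hi) (xsa i hi).
- have [aK _ _] := hK i hi; apply: bdK aK (w2 i hi) _; rewrite yeq_ent2 //.
  have h := rxa i hi; case: eqP => // ni.
  have hi' : in1n n.-1 i by move: hi ni; rewrite /in1n; clear; lia.
  have /andP[P0 P1] := fm_P fm hi'; have /andP[h0 h1] := h.
  by rewrite mulr_ge0 //= (le_trans _ h1) // ler_piMl // ltW.
- have hi' : in1n n i by move: hi; rewrite /in1n; clear; lia.
  have [aK _ _] := hK i hi'; apply: bdK aK (w3 i hi) _; rewrite yeq_ent3 //.
  have /andP[P0 P1] := fm_P fm hi; have /andP[h0 h1] := rxa i hi'.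
  by rewrite mulr_ge0 ?subr_ge0 ?(ltW P1) //= (le_trans _ h1) // ler_piMl // gerBl.
have unit_itv (y : R) : 0 <= y <= 1 - eps -> 0 <= y <= 1.
  by move=> /andP[-> h]; apply: le_trans h _; rewrite gerBl ltW.
have unit_itv' (y : R) : eps <= y <= 1 - eps -> 0 <= y <= 1.
  by move=> /andP[h1 h2]; apply: unit_itv; rewrite h2 (le_trans (ltW e0)).
split=> [i hi|i hi|i iJ].
- have hi' : in1n n i by move: hi; rewrite /in1n; clear; lia.
  have [_ _ K1] := hK i hi'.
  by apply: bdK K1 (unit_itv _ (tP i hi)) (unit_itv _ (bd_P bd hi)).
- have [_ _ K1] := hK i hi.
  by apply: bdK K1 (unit_itv' _ (tr i hi)) (unit_itv' _ (bd_r bd hi)).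
have hi := ix_in1n iJ; have [_ vK _] := hK i hi.
exact: bdK vK (vfull_bounds thT hi) (vs_bounds hi).
Qed.

(* Close to the equilibrium one step of the closed loop is Lipschitz, and away
   from it the bound holds since the state space is bounded. *)
Lemma step_within : exists2 C : R, 1 <= C & forall d x w th B,
  d \in @dist_set R n -> x \in state_set a -> w \in output_set a ->
  th \in Theta_set vmax eps -> 0 <= B -> state_within B x w th ->
  state_within (C * B) (Ftilde a q c f P d x (input th x))
    (measure_out a q c f d th0 x (controller mu b sigma eps tau g th x))
    (next_param x w th).
Proof.
have [Cu Cu0 hu] := input_lipschitz; have [K K0 hK] := state_within_bounded.
have [rho rho0 hrho] := near_radius.
have Kr : 0 <= K / rho by rewrite divr_ge0 // ltW.
have r2 : 0 <= 2 / rho by rewrite divr_ge0 // ltW.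
(* [2 + Cu] and [5 + 2 / rho] come from the near regime; [K / rho] serves the far one, where
   [K <= K / rho * B]. *)
exists (5 + Cu + 2 / rho + K / rho) => [|d x w th B dD xS wY thT B0 near]; first by lra.
have [rB|Br] := leP rho B.
  apply: (@state_withinW K).
    have : K <= K / rho * B by rewrite mulrAC ler_pdivlMr // ler_wpM2l.
    have := mulr_ge0 Cu0 B0; have := mulr_ge0 r2 B0; nra.
  apply: hK; last exact: next_param_Theta.
    by apply: (Ftilde_state hn fm dD xS); apply: input_nonneg.
  exact: measure_output_set.
have inC i : in1n n i -> `|(input th x)#i - vs#i| <= Cu * B.
  move=> hi; apply: hu => //; [exact: sw_th near|exact: sw_x near].
have hCu := mulr_ge0 Cu0 B0; have hr2 := mulr_ge0 r2 B0; have hKr := mulr_ge0 Kr B0.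
have Brho := ltW Br.
split.
- move=> i hi; apply: le_trans (near_step_x dD xS thT rho0 B0 Brho hrho near inC hi) _; nra.
- move=> i hi; rewrite measure_ent1; apply: le_trans (sw_x near hi) _; nra.
- move=> i hi; apply: le_trans (near_step_w2 dD xS thT rho0 Brho hrho near hi) _; nra.
- move=> i hi; apply: le_trans (near_step_w3 dD xS thT rho0 Brho hrho near hi) _; nra.
apply: param_withinW (near_step_th wY rho0 B0 Brho hrho near); nra.
Qed.

Definition total_error (x : 'rV[R]_n) (w : output R n) (th : param R J) : R :=
  enorm (x - xs) + enorm_out (w - yeq P r vs) + enorm (parr th - r)
  + enorm (parP th - P) + enorm (vfull g th - vs).

Definition initial_error (x : 'rV[R]_n) (w : output R n) (th : param R J) : R :=
  enorm (x - xs) + enorm_out (w - yeq P r vs) + enorm (parr th - r)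
  + enorm (parP th - P) + \sum_(i <- ix (~: J)) `|(vfull g th)#i - vs#i|.

Lemma enorm_out_ge0 (w : output R n) : 0 <= enorm_out w.
Proof. exact: sqrtr_ge0. Qed.

Lemma initial_error_ge0 x w th : 0 <= initial_error x w th.
Proof. by rewrite !addr_ge0 ?enorm_ge0 ?enorm_out_ge0 //; apply: sumr_ge0. Qed.

Lemma initial_within x w th : state_within (initial_error x w th) x w th.
Proof.
rewrite /initial_error.
have p1 := enorm_ge0 (x - xs); have p2 := enorm_out_ge0 (w - yeq P r vs).
have p3 := enorm_ge0 (parr th - r); have p4 := enorm_ge0 (parP th - P).
have p5 : 0 <= \sum_(i <- ix (~: J)) `|(vfull g th)#i - vs#i| by apply: sumr_ge0.
have [g1 g2 g3] := enorm_out_ge (w - yeq P r vs).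
split; [| | | |split] => i hi; rewrite -?entB.
- apply: le_trans (ent_le_enorm _ hi) _; lra.
- apply: le_trans (ent_le_enorm (w - yeq P r vs).1.1 hi) _; lra.
- apply: le_trans (ent_le_enorm (w - yeq P r vs).1.2 hi) _; lra.
- apply: le_trans (ent_le_enorm (w - yeq P r vs).2 hi) _; lra.
- apply: le_trans (ent_le_enorm _ hi) _; lra.
- apply: le_trans (ent_le_enorm _ hi) _; lra.
have : `|(vfull g th)#i - vs#i| <= \sum_(i <- ix (~: J)) `|(vfull g th)#i - vs#i|.
  by rewrite (big_rem i) //= lerDl; apply: sumr_ge0.
by rewrite entB; lra.
Qed.

(** The inflow estimates in [J], absent from [state_within], are recovered through
    [vfull_lipschitz]. In [6 + Cg], the output accounts for 3, the densities, [r] and [P] for 1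
    each. *)
Lemma total_error_le : exists2 L : R, 0 < L & forall B x w th, 0 <= B ->
  th \in Theta_set vmax eps -> state_within B x w th -> total_error x w th <= L * B.
Proof.
have [Cg Cg0 hg] := vfull_lipschitz.
have n0 : (0 : R) < n%:R by rewrite ltr0n; move: hn; clear; lia.
exists (n%:R * (6 + Cg)) => [|B x w th B0 thT [h1 h2 h3 h4 h5]].
  by rewrite mulr_gt0 // ltr_pwDl.
have nB : 0 <= n%:R * B by rewrite mulr_ge0 // ltW.
have predB : n.-1%:R * B <= n%:R * B by rewrite ler_wpM2r // ler_nat leq_pred.
have [pP pr _] := h5.
have e1 : enorm (x - xs) <= n%:R * B.
  by apply: enorm_le => // i hi; rewrite entB; apply: h1.
have e2 : enorm_out (w - yeq P r vs) <= 3 * (n%:R * B).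
  apply: enorm_out_le => //.
  - by apply: enorm_le => // i hi; rewrite entB; apply: h2.
  - by apply: enorm_le => // i hi; rewrite entB; apply: h3.
  - by apply: le_trans predB; apply: enorm_le => // i hi; rewrite entB; apply: h4.
have e3 : enorm (parr th - r) <= n%:R * B.
  by apply: enorm_le => // i hi; rewrite entB; apply: pr.
have e4 : enorm (parP th - P) <= n%:R * B.
  by apply: le_trans predB; apply: enorm_le => // i hi; rewrite entB; apply: pP.
have e5 : enorm (vfull g th - vs) <= n%:R * (Cg * B).
  apply: enorm_le => [|i hi]; first exact: mulr_ge0.
  by rewrite entB; apply: hg.
by rewrite /total_error; nra.
Qed.

(** A fictitious state whose only error is in the density. As the next [x] and [w] do not depend on
    the present [w], [step_within] applied to it bounds them by the error of [x] alone once the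
    parameters are exact. *)
Lemma equilibrium_within x : state_within (enorm (x - xs)) x (yeq P r vs) th0.
Proof.
have B0 := enorm_ge0 (x - xs).
split; [| | | |split] => i hi; rewrite ?vfull_true ?subrr ?normr0 //.
by rewrite -entB; apply: ent_le_enorm.
Qed.

Lemma yeq_output : yeq P r vs \in output_set a.
Proof.
rewrite inE; have rx i : in1n n i -> 0 <= r#i * xs#i <= a#i.
  move=> hi; have /andP[r0 r1] := fm_r fm hi; have x0 := xs_pos hi.
  by rewrite mulr_ge0 ?(ltW r0) ?(ltW x0) //= (le_trans _ (ltW (xs_lt_a hi))) // ler_piMl // ltW.
split=> [|i hi|i hi].
- by rewrite inE => i hi; rewrite xs_pos //= ltW ?xs_lt_a.
- rewrite yeq_ent2 //; have /andP[h0 h1] := rx i hi; case: eqP => [_|ni]; first by rewrite h0.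
  have hi' : in1n n.-1 i by move: hi ni; rewrite /in1n; clear; lia.
  have /andP[P0 P1] := fm_P fm hi'.
  by rewrite mulr_ge0 //= (le_trans _ h1) // ler_piMl // ltW.
have hi' : in1n n i by move: hi; rewrite /in1n; clear; lia.
rewrite yeq_ent3 //; have /andP[P0 P1] := fm_P fm hi; have /andP[h0 h1] := rx i hi'.
by rewrite mulr_ge0 ?subr_ge0 ?(ltW P1) //= (le_trans _ h1) // ler_piMl // gerBl.
Qed.

(** * From the nominal decay to the exponential estimate *)

Section Conclusion.
Variable N : nat.
Hypothesis settled : forall d x w th,
  closed_loop_from a q c f mu vmax b sigma eps tau g th0 d x w th ->
  forall t, (N <= t)%N -> th t = th0.
Hypothesis rges : RGES (state_set a) (@dist_set R n)
  (fun d x => Ftilde a q c f P d x (nominal_input J b sigma tau vs xs x)) xs.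

Lemma exponential_estimate : exists M s : R, [/\ 0 < M, 0 < s &
  forall d x w th,
    closed_loop_from a q c f mu vmax b sigma eps tau g th0 d x w th ->
    forall t, total_error (x t) (w t) (th t) <=
      M * expR (- (s * t%:R)) * initial_error (x 0%N) (w 0%N) (th 0%N)].
Proof.
have [C C1 step] := step_within; have [L L0 hL] := total_error_le.
have C0 : 0 < C by apply: lt_le_trans C1.
have [M0 [s [M00 s0 hM]]] := rges.
(* Compensates the decay missing in the first [N] steps and in the one step by which [w] lags behind
   [x]. *)
pose E1 := expR (s * N.+1%:R).
have E10 : 0 < E1 := expR_gt0 _.
pose K1 := L * C ^+ N; have K10 : 0 < K1 by rewrite mulr_gt0 ?exprn_gt0.
(* The first term serves [t <= N], where errors grow at most by [C] per step; the second serves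
   later times, when the nominal loop starts from an error of at most [K1 * e0]. *)
exists (K1 * E1 + L * C * M0 * E1 * K1), s; split => //.
  by rewrite addr_gt0 ?mulr_gt0 ?exprn_gt0.
move=> d x w th sol t; set e0 := initial_error _ _ _.
have e00 : 0 <= e0 := initial_error_ge0 _ _ _.
have within u : state_within (C ^+ u * e0) (x u) (w u) (th u).
  elim: u => [|u IH]; first by rewrite expr0 mul1r; apply: initial_within.
  rewrite exprS -mulrA (sol_x sol) (sol_w sol) (sol_th sol); apply: step => //.
  - exact: sol_dist sol u.
  - exact: sol_state sol u.
  - exact: sol_output sol u.
  - exact: sol_Theta sol u.
  - by rewrite mulr_ge0 ?exprn_ge0 // ltW.
have early u : (u <= N)%N -> total_error (x u) (w u) (th u) <= K1 * e0.
  move=> uN; apply: le_trans (hL _ _ _ _ _ (sol_Theta sol u) (within u)) _.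
    by rewrite mulr_ge0 ?exprn_ge0 // ltW.
  rewrite /K1 -mulrA ler_wpM2l ?(ltW L0) // ler_wpM2r //.
  exact: ler_weXn2l.
set Et := expR _; have Et0 : 0 < Et := expR_gt0 _.
have [tN|Nt] := leqP t N.
  apply: le_trans (early t tN) _; rewrite ler_wpM2r //.
  have EE : 1 <= E1 * Et.
    rewrite -expRD -[leLHS]expR0 ler_expR; rewrite -mulrN -mulrDr mulr_ge0 ?(ltW s0) //.
    by rewrite subr_ge0 ler_nat ltnW.
  have : 0 <= L * C * M0 * E1 * K1 * Et by rewrite ltW // !mulr_gt0 ?exprn_gt0.
  rewrite mulrDl -mulrA; have := ler_wpM2l (ltW K10) EE; lra.
pose u := (t - N.+1)%N.
have et : t = (N + u).+1 by rewrite /u; move: Nt; clear; lia.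
have thu : th (N + u) = th0 by apply: (settled sol); rewrite leq_addr.
have dec : enorm (x (N + u) - xs) <= M0 * expR (- (s * u%:R)) * enorm (x N - xs).
  have := hM (fun i => d (N + i)%N) (fun i => x (N + i)%N); rewrite addn0; apply.
  - by move=> i; apply: sol_dist sol _.
  - exact: sol_state sol N.
  - by move=> i; rewrite addnS; apply: (sol_shift sol) => i' ; apply: (settled sol).
have ex : x t = Ftilde a q c f P (d (N + u)) (x (N + u)) (input th0 (x (N + u))).
  by rewrite et (sol_x sol) thu.
have ew : w t = measure_out a q c f (d (N + u)) th0 (x (N + u))
    (controller mu b sigma eps tau g th0 (x (N + u))).
  by rewrite et (sol_w sol) thu.
have near : state_within (C * enorm (x (N + u) - xs)) (x t) (w t) (th t).
  (* The true [w] is replaced by the equilibrium output, which changes neither [x t] nor [w t]; the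
     parameter clause is discarded, as [th t] is known to be exact. *)
  have := step _ _ _ _ _ (sol_dist sol (N + u)) (sol_state sol (N + u)) yeq_output
     th0_Theta (enorm_ge0 _) (equilibrium_within (x (N + u))).
  rewrite -ex -ew => -[h1 h2 h3 h4 _].
  split => //.
  have -> : th t = th0 by apply: (settled sol); rewrite ltnW.
  have [_ _ _ _ h] := equilibrium_within (x (N + u)).
  apply: param_withinW h; rewrite ler_peMl ?enorm_ge0 //.
have xN : enorm (x N - xs) <= K1 * e0.
  apply: le_trans (early N (leqnn N)); rewrite /total_error -!addrA lerDl.
  by rewrite !addr_ge0 ?enorm_ge0 ?enorm_out_ge0.
have eE : expR (- (s * u%:R)) = E1 * Et.
  rewrite -expRD; congr expR; rewrite et -addSn natrD; ring.
apply: le_trans (hL _ _ _ _ _ (sol_Theta sol t) near) _.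
  by rewrite mulr_ge0 ?enorm_ge0 // ltW.
have LC : 0 <= L * C by rewrite ltW // mulr_gt0.
have ME : 0 <= M0 * (E1 * Et) by rewrite ltW // !mulr_gt0.
rewrite eE in dec.
have h1 := ler_wpM2l LC dec; have h2 := ler_wpM2l LC (ler_wpM2l ME xN).
have h3 : 0 <= K1 * E1 * Et * e0 by rewrite mulr_ge0 // ltW // !mulr_gt0 ?exprn_gt0.
apply: (@le_trans _ _ (L * C * (M0 * (E1 * Et) * (K1 * e0)))).
  by apply: le_trans h2; rewrite mulrA.
by rewrite [leRHS](_ : _ = K1 * E1 * Et * e0 + L * C * (M0 * (E1 * Et) * (K1 * e0))) ?lerDr //; ring.
Qed.

End Conclusion.
End ClosedLoop.

Theorem corollary3p3 (R : realType) (n : nat) (hn : (3 <= n)%N) (J : {set 'I_n})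
    (a q c : 'rV[R]_n) (f : nat -> R -> R) (mu : 'rV[R]_n) (P : 'rV[R]_n.-1)
    (vmaxJ : 'rV[R]_#|J|) :
  exists2 eta : R, 0 < eta &
  forall (delta r fmin vs vmax b : 'rV[R]_n) (sigma eps : R)
    (g : param R J -> 'rV[R]_#|J|),
  freeway_model a q c f delta r fmin P ->
  equilibrium_inflow a q c delta r P vs ->
  bounds a q c J delta r P vs mu vmax b sigma eps ->
  nominal_stabilization a q c f J P r vs b sigma ->
  inflow_map vmax b eps P r vs g ->
  subvec J vmax = vmaxJ ->
  (forall i, i \in ix J -> b#i <= eta) ->
  (forall i, i \in ix (~: J) -> vmax#i <= eta) ->
  exists2 taubar : R, 0 < taubar &
  forall tau : R, 0 < tau < taubar ->
  let xs := xeq P r vs in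
  let ys := yeq P r vs in
  let solution :=
    closed_loop_from a q c f mu vmax b sigma eps tau g (true_param J P r vs) in
  (exists M sbar : R, [/\ 0 < M, 0 < sbar &
     forall d x w th, solution d x w th -> forall t : nat,
       enorm (x t - xs) + enorm_out (w t - ys) + enorm (parr (th t) - r)
       + enorm (parP (th t) - P) + enorm (vfull g (th t) - vs)
       <= M * expR (- (sbar * t%:R)) *
          (enorm (x 0%N - xs) + enorm_out (w 0%N - ys)
           + enorm (parr (th 0%N) - r) + enorm (parP (th 0%N) - P)
           + \sum_(i <- ix (~: J)) `| (vfull g (th 0%N))#i - vs#i |)]) /\
  (exists2 N : nat, (1 <= N)%N &
     forall d x w th, solution d x w th -> forall t : nat, (N <= t)%N ->
       [/\ parP (th t) = P, parr (th t) = r & vfull g (th t) = vs]).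
Proof.
(* [k] has to be chosen before [delta], [r] and [fmin]. If there is none, [drain_bound_gt0] shows
   that no choice of them meets the hypotheses, and any [eta] will do. *)
have [[k [k0 hk]]|nok] := pselect (exists k : R, 0 < k /\ drain_bound a q c f mu k); last first.
  exists 1 => // delta r fmin vs vmax b sigma eps g fm _ bd.
  by have [k k0 hk] := drain_bound_gt0 fm (bd_mu bd); case: nok; exists k.
have n2 : (0 : R) < (n ^ 2)%:R by rewrite ltr0n expn_gt0; lia.
(* With this [eta] the inflows raise the mass by at most [k / 2] per step. *)
exists (k / 2 / (n ^ 2)%:R); first by rewrite !divr_gt0.
move=> delta r fmin vs vmax b sigma eps g fm _ bd [taus taus0 nom] im _ hb hv.
have /andP[e0 _] := bd_eps bd; have /andP[s0 _] := bd_sigma bd.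
(* The first bound is for nominal stability, the second for the saturation off [Omega]. *)
exists (Num.min taus (sigma ^+ n * eps)).
  by rewrite lt_min taus0 mulr_gt0 ?exprn_gt0.
move=> tau /andP[tau0]; rewrite lt_min => /andP[tt /ltW te] /=.
have eta_small : k / 2 / (n ^ 2)%:R *+ n ^ 2 <= k / 2.
  by rewrite -mulr_natr divfK ?gt_eqF.
have etak : k / 2 / (n ^ 2)%:R <= k.
  have : k / 2 / (n ^ 2)%:R <= k / 2.
    by rewrite ler_pdivrMr // ler_peMr ?divr_ge0 ?(ltW k0) // ler1n expn_gt0; lia.
  by lra.
have [N N1 settled] := settling_time hn fm bd im tau0 k0 hk etak eta_small te hb hv.
have taut : 0 < tau < taus by rewrite tau0.
split; last first.
  exists N => // d x w th sol t Nt; rewrite (settled d x w th sol t Nt).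
  by split=> //; exact: vfull_true im.
have [M [s [M0 s0' hM]]] := exponential_estimate hn fm bd im tau0 settled (nom tau taut).
by exists M, s.
Qed.
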